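(* Let $\mathbb{P}=\mathcal{M}_1\times\cdots\times\mathcal{M}_k$ be a product of constant-curvature model spaces (each factor a hyperbolic space $\mathbb{H}^{n_i}_{K_i}$ in the Lorentz model, a sphere $\mathbb{S}^{n_i}_{R_i}$, or a Euclidean space $\mathbb{E}^{n_i}$) with product origin $\mathbf{o}=(o_1,\dots,o_k)$. Fix $\tau_i>0$ and $V=(V_1,\dots,V_k)\in T_{\mathbf o}\mathbb{P}$, and let $f=(f_1,\dots,f_k)$ with $f_i:\mathbb{P}\times[0,T]\to[0,1]$ continuously differentiable. Consider the ODE on $\mathbb{P}$, written factorwise, $$\dot x_i(t)=\Big(\tfrac{1}{\tau_i}+f_i(x(t),t)\Big)\log_{x_i(t)}(o_i)+f_i(x(t),t)\,P_{o_i\to x_i(t)}(V_i),\qquad i=1,\dots,k,$$ with initial value $x(0)=x_0$, and the Geodesic Decay (GD) scheme with uniform step $\Delta t=T/N$, $t_j=j\Delta t$: $$x^{*}=\mathrm{Exp}_{x_j}\big(\Delta t\,(f(x_j,t_j)\odot P_{\mathbf o\to x_j}(V))\big),\qquad x_{j+1}=\mathrm{Exp}_{\mathbf o}\Big(e^{-\Delta t\,(1/\tau+f(x_j,t_j))}\odot \mathrm{Log}_{\mathbf o}(x^{*})\Big),$$ where $\odot$ multiplies the $i$-th factor component by the $i$-th scalar. Assume the exact solution $x(t)$ exists on $[0,T]$ and that the exact trajectory and all iterates and intermediate points lie in a compact region on which all exponential maps, logarithmic maps and parallel transports used above are well defined and smooth (i.e. away from cut loci). Then the GD scheme is first-order convergent: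 there are constants $C,h_0>0$ (independent of $N$) such that for all $\Delta t\le h_0$, $$\max_{0\le j\le N} d_{\mathbb{P}}\big(x_j,x(t_j)\big)\le C\,\Delta t .$$
   Context: On each factor: for the hyperbolic (Lorentz) model $\mathbb{H}^n_K=\{x\in\mathbb{R}^{n+1}:\langle x,x\rangle_{\mathcal L}=-K,x_0>0\}$ with origin $(\sqrt K,0,\dots,0)$; for the sphere $\mathbb{S}^n_R=\{p\in\mathbb{R}^{n+1}:\|p\|=R\}$ with origin $(R,0,\dots,0)$; for $\mathbb{E}^n$ origin $0$. $\exp_x,\log_x$ denote the Riemannian exponential and logarithm maps, $P_{x\to y}$ Levi-Civita parallel transport along the minimizing geodesic. On $\mathbb{P}$, $\mathrm{Exp},\mathrm{Log}$ and $P$ act factorwise, and $d_{\mathbb{P}}(x,y)=\sum_i d_{\mathcal{M}_i}(x_i,y_i)$ is the sum of factor geodesic distances. *)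

(* Defs.v *)
From HB Require Import structures.
From mathcomp Require Import all_boot all_order all_algebra.
From mathcomp Require Import all_classical all_reals all_analysis.
Set Implicit Arguments. Unset Strict Implicit. Unset Printing Implicit Defensive.
Import Order.TTheory GRing.Theory Num.Theory.
Import numFieldNormedType.Exports.
Local Open Scope classical_set_scope.
Local Open Scope ring_scope.

(* A constant-curvature model space: hyperbolic space H^n_K (Lorentz model,
   parameter K > 0), sphere S^n_R (radius R > 0), or Euclidean space E^n. *)
Inductive model (R : Type) := Hyp of R | Sph of R | Euc.
Arguments Euc {R}.

Definition amb {R} (M : model R) (n : nat) : nat :=
  match M with Euc => n | _ => n.+1 end.

Section Factor.
Variable R : realType.
Variable m : nat.
Implicit Types (x y u v : 'rV[R]_m).

Definition coord0 x : R := \sum_(j < m | val j == 0%N) x 0 j.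
Definition einner u v : R := \sum_(j < m) u 0 j * v 0 j.
Definition linner u v : R :=
  \sum_(j < m) (if val j == 0%N then -1 else 1) * u 0 j * v 0 j.

Definition inner (M : model R) u v : R :=
  match M with Hyp _ => linner u v | _ => einner u v end.
Definition tnorm (M : model R) v : R := Num.sqrt (inner M v v).

Definition param_pos (M : model R) : Prop :=
  match M with Hyp K => 0 < K | Sph r => 0 < r | Euc => True end.

Definition origin_pt (M : model R) : 'rV[R]_m :=
  match M with
  | Hyp K => \row_(j < m) (if val j == 0%N then Num.sqrt K else 0)
  | Sph r => \row_(j < m) (if val j == 0%N then r else 0)
  | Euc => 0
  end.

Definition on_model (M : model R) x : Prop :=
  match M with
  | Hyp K => linner x x = - K /\ 0 < coord0 x
  | Sph r => einner x x = r ^+ 2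
  | Euc => True
  end.

Definition is_tangent (M : model R) x v : Prop :=
  match M with Euc => True | _ => inner M x v = 0 end.

Definition coshR (z : R) : R := (expR z + expR (- z)) / 2.
Definition sinhR (z : R) : R := (expR z - expR (- z)) / 2.
Definition acoshR (z : R) : R := ln (z + Num.sqrt (z ^+ 2 - 1)).

Definition gdist (M : model R) x y : R :=
  match M with
  | Hyp K => Num.sqrt K * acoshR (- linner x y / K)
  | Sph r => r * acos (einner x y / r ^+ 2)
  | Euc => Num.sqrt (einner (y - x) (y - x))
  end.

Definition expm (M : model R) x v : 'rV[R]_m :=
  match M with
  | Hyp K => if v == 0 then x else
      let a := tnorm M v / Num.sqrt K in
      coshR a *: x + (Num.sqrt K * sinhR a / tnorm M v) *: v
  | Sph r => if v == 0 then x else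
      let a := tnorm M v / r in
      cos a *: x + (r * sin a / tnorm M v) *: v
  | Euc => x + v
  end.

Definition logm (M : model R) x y : 'rV[R]_m :=
  match M with
  | Hyp K => let u := y + (linner x y / K) *: x in
      if u == 0 then 0 else (gdist M x y / tnorm M u) *: u
  | Sph r => let u := y - (einner x y / r ^+ 2) *: x in
      if u == 0 then 0 else (gdist M x y / tnorm M u) *: u
  | Euc => y - x
  end.

(* Levi-Civita parallel transport P_{x -> y}(v) along the minimizing geodesic *)
Definition ptm (M : model R) x y v : 'rV[R]_m :=
  match M with
  | Hyp K => v + (linner y v / (K - linner x y)) *: (x + y)
  | Sph r => v - (einner y v / (r ^+ 2 + einner x y)) *: (x + y)
  | Euc => v
  end.

(* y is not in the cut locus of o (the cut locus is {-o} on the sphere and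
   empty on H^n and E^n) *)
Definition not_cut (M : model R) o y : Prop :=
  match M with Sph _ => y <> - o | _ => True end.

End Factor.

(* The product manifold P = M_1 x ... x M_k, embedded block-wise in
   'rV_(sum_i amb_i). *)
Section Product.
Variable R : realType.
Variable k : nat.
Variable kd : 'I_k -> model R.
Variable n : 'I_k -> nat.

Definition dims (i : 'I_k) : nat := amb (kd i) (n i).
Definition Pamb := 'rV[R]_(\sum_(i < k) dims i).

Definition fcomp (x : Pamb) (i : 'I_k) : 'rV[R]_(dims i) :=
  @submxrow R k dims 1 x i.
Definition mk (g : forall i : 'I_k, 'rV[R]_(dims i)) : Pamb :=
  @mxrow R k dims 1 g.

Definition onP (x : Pamb) : Prop := forall i, on_model (kd i) (fcomp x i).
Definition orig (i : 'I_k) : 'rV[R]_(dims i) := origin_pt (dims i) (kd i).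
Definition origP : Pamb := mk orig.

Definition dP (x y : Pamb) : R := \sum_(i < k) gdist (kd i) (fcomp x i) (fcomp y i).

Variable tau : 'I_k -> R.
Variable V : Pamb.
Variable f : 'I_k -> Pamb -> R -> R.

Definition ode_field (x : Pamb) (t : R) : Pamb :=
  mk (fun i => ((tau i)^-1 + f i x t) *: logm (kd i) (fcomp x i) (orig i)
               + f i x t *: ptm (kd i) (orig i) (fcomp x i) (fcomp V i)).

Definition gd_star (h t : R) (x : Pamb) : Pamb :=
  mk (fun i => expm (kd i) (fcomp x i)
                 ((h * f i x t) *: ptm (kd i) (orig i) (fcomp x i) (fcomp V i))).

Definition gd_step (h t : R) (x : Pamb) : Pamb :=
  mk (fun i => expm (kd i) (orig i)
        (expR (- (h * ((tau i)^-1 + f i x t)))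
           *: logm (kd i) (orig i) (fcomp (gd_star h t x) i))).

Fixpoint gd_iter (h : R) (x0 : Pamb) (j : nat) : Pamb :=
  match j with
  | O => x0
  | j'.+1 => gd_step h (j'%:R * h) (gd_iter h x0 j')
  end.

End Product.

Definition C1_on {R : realType} {W : normedModType R} (U : set W) (g : W -> R) : Prop :=
  open U /\
  (forall z, U z -> differentiable g z) /\
  (forall (v : W) z, U z -> {for z, continuous (fun w => 'D_v g w)}).

(* Main.v *)
Require Import Defs.
From HB Require Import structures.
From mathcomp Require Import all_boot all_order all_algebra.
From mathcomp Require Import all_classical all_reals all_analysis.
From mathcomp Require Import ring lra.

(* Work with the sup norm of the ambient space.  On the compact region the
   vector field is Lipschitz in space and time, so by the discrete Gronwall
   inequality a one-step error of order h^2 is enough, and geodesic distance is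
   bounded by a multiple of the ambient distance.

   The one-step error is obtained from the reversal identity
   exp_o (s log_o z) = exp_z ((1 - s) log_z o): both half-steps of the scheme are
   then exponentials based at the current point, to which the single expansion
   exp_z v = z + v + O(|v|^2) applies.  The sphere and the hyperboloid are treated
   together, as quadrics of curvature sign eps with the pairs (cos, sin) and
   (cosh, sinh); there log_z o = g(c) (o - c z), where c is the (hyperbolic) cosine
   of the distance and g(c) is the angle divided by its sine, which is Lipschitz in c
   away from the cut locus, including at c = 1. *)

Import Order.TTheory GRing.Theory Num.Theory.
Import numFieldNormedType.Exports.
Local Open Scope classical_set_scope.
Local Open Scope ring_scope.
Set Implicit Arguments.
Unset Strict Implicit.
Unset Printing Implicit Defensive.

(** Two regularity obstacles shape the proof. Each [f i] is C^1 only on an open set around the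
    space-time region, and the compact region is not convex, so the mean value theorem along
    segments compares nearby points only; boundedness deals with the distant ones. Moreover [acos]
    and [acoshR] have a square-root singularity at 1, that is at coinciding points, so no Lipschitz
    bound can pass through the angle alone. In the logarithm the angle appears divided by its sine.
    The derivative of this ratio with respect to the angle is bounded by a multiple of the sine,
    which is also the size of the derivative of the cosine, so the singularity cancels in a Cauchy
    mean value argument. In the distance it cancels because |1 - c| is quadratic in the chord x - y.
    Trajectory, iterates and intermediate points share one compact set, so every constant is
    independent of N and of the size of the step. *)

(** * Lipschitz bounds for C^1 functions on compact sets *)

Lemma rV_norm_le (R : realType) (m : nat) (v : 'rV[R]_m) (a : R) :
  0 <= a -> (forall j, `|v 0 j| <= a) -> `|v| <= a.
Proof.
move=> a0 va; rewrite [leLHS]/Num.Def.normr /= mx_normrE.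
by apply: bigmax_le => // -[i j] _; rewrite ord1.
Qed.

Lemma rV_coord_le (R : realType) (m : nat) (v : 'rV[R]_m) j : `|v 0 j| <= `|v|.
Proof.
rewrite [leRHS]/Num.Def.normr /= mx_normrE.
by apply/bigmax_geP; right; exists (0, j).
Qed.

Lemma is_derive_line (R : realType) (W : normedModType R) (g : W -> R) (a v : W)
    (s : R) : differentiable g (a + s *: v) ->
  is_derive s 1 (fun s => g (a + s *: v)) ('D_v g (a + s *: v)).
Proof.
move=> dg.
have E : (fun h : R => h^-1 *: (((fun s => g (a + s *: v)) \o shift s) (h *: 1)
            - g (a + s *: v)))
       = (fun h => h^-1 *: ((g \o shift (a + s *: v)) (h *: v) - g (a + s *: v))).
  apply/funext => h /=; congr (_ *: (g _ - _)).
  by rewrite scalerDl [h *: 1]mulr1 addrCA.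
split; last by rewrite /derive E.
by rewrite /derivable E; exact: diff_derivable.
Qed.

(** The differential is linear, so the m space directions and the time direction bound it in every
    direction. [C1_on] gives continuity of the derivative for one fixed direction at a time; this
    passes from finitely many directions to all. *)
Lemma derive_pair_le (R : realType) (m : nat) (g : 'rV[R]_m * R -> R) z v (M : R) :
  differentiable g z ->
  (forall j, `|'D_(delta_mx 0 j, 0) g z| <= M) -> `|'D_(0, 1) g z| <= M ->
  `|'D_v g z| <= (m%:R + 1) * M * `|v|.
Proof.
move=> dg hM hM1.
have M0 : 0 <= M by apply: le_trans hM1.
have Ev : v = \sum_(j < m) v.1 0 j *: (delta_mx 0 j, 0) + v.2 *: (0, 1)
    :> 'rV[R]_m * R.
  case: v => v t; rewrite [RHS]surjective_pairing; congr pair => /=.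
    rewrite (raddf_sum (@fst _ _)) /= scaler0 addr0 {1}[v]row_sum_delta.
    by apply: eq_bigr => j _.
  rewrite (raddf_sum (@snd _ _)) /= big1 ?add0r ?[_ *: _]mulr1//.
  by move=> j _ /=; rewrite scaler0.
have Ed : 'D_v g z = \sum_(j < m) v.1 0 j * 'D_(delta_mx 0 j, 0) g z
                     + v.2 * 'D_(0, 1) g z.
  rewrite deriveE // {1}Ev linearD linear_sum linearZ /= deriveE //.
  by congr (_ + _); apply: eq_bigr => j _; rewrite linearZ /= deriveE.
have v1 : `|v.1| <= `|v| by rewrite [leRHS]/Num.Def.normr /= le_max lexx.
have v2 : `|v.2| <= `|v| by rewrite [leRHS]/Num.Def.normr /= le_max lexx orbT.
rewrite Ed (le_trans (ler_normD _ _))//.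
rewrite -mulrA mulrDl mul1r lerD //; last by rewrite normrM mulrC ler_pM.
rewrite (le_trans (ler_norm_sum _ _ _))//.
rewrite mulr_natl -[X in _ *+ X]card_ord -sumr_const.
apply: ler_sum => j _; rewrite normrM mulrC ler_pM //.
exact: le_trans (rV_coord_le _ _) v1.
Qed.

(** The m + 1 partial derivatives are bounded on some ball around [p]; the ball is convex, so the
    segment from [q'] to [q] stays in it and the mean value theorem applies there. *)
Lemma C1_locally_lipschitz (R : realType) (m : nat) (U : set ('rV[R]_m * R))
    (g : 'rV[R]_m * R -> R) p : C1_on U g -> U p ->
  exists L e : R, [/\ 0 <= L, 0 < e & forall q q', `|q - p| < e -> `|q' - p| < e ->
    `|g q - g q'| <= L * `|q - q'| ].
Proof.
move=> [oU [dU cU]] Up.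
have bd v : \forall z \near p, `|'D_v g z| <= `|'D_v g p| + 1.
  have /cvgrPdist_le /(_ 1 ltr01) := cU v p Up.
  apply: filterS => z hz.
  rewrite -[X in `|X|](subrK ('D_v g p)) addrC (le_trans (ler_normD _ _))//.
  by rewrite lerD2l distrC.
set M := \sum_(j < m) (`|'D_(delta_mx 0 j, 0) g p| + 1) + (`|'D_(0, 1) g p| + 1).
have M0 : 0 <= M by rewrite addr_ge0 // ?addr_ge0 // sumr_ge0 // => j _; rewrite addr_ge0.
have near_good : \forall z \near p, U z /\
    ((forall j, `|'D_(delta_mx 0 j, 0) g z| <= M) /\ `|'D_(0, 1) g z| <= M).
  apply: filterI; first exact: open_nbhs_nbhs.
  apply: filterI; last first.
    apply: filterS (bd (0, 1)) => z /le_trans; apply.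
    by rewrite /M lerDr sumr_ge0 // => j _; rewrite addr_ge0.
  apply: (@filter_forall _ 'I_m
    (fun j z => `|'D_(delta_mx 0 j, 0) g z| <= M) (nbhs p)) => j.
  apply: filterS (bd (delta_mx 0 j, 0)) => z /le_trans; apply; rewrite /M (bigD1 j) //= -addrA lerDl addr_ge0 // ?addr_ge0 //.
  by rewrite sumr_ge0 // => i _; rewrite addr_ge0.
move/nbhs_normP : near_good => [e /= e0 good].
exists ((m%:R + 1) * M), e; split=> // [|q q' qp q'p].
  by rewrite mulr_ge0 // addr_ge0.
have seg s : 0 <= s <= 1 -> `|q' + s *: (q - q') - p| < e.
  move=> /andP[s0 s1].
  have -> : q' + s *: (q - q') - p = (1 - s) *: (q' - p) + s *: (q - p).
    have -> : q - q' = (q - p) - (q' - p) by rewrite opprB addrA subrK.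
    move: (q - p) => Q; rewrite addrAC; move: (q' - p) => Q'.
    by rewrite scalerBr scalerBl scale1r [RHS]addrAC addrA.
  rewrite (le_lt_trans (ler_normD _ _))// !normrZ ger0_norm ?subr_ge0// (ger0_norm s0).
  have [->|sn] := eqVneq s 0; first by rewrite subr0 mul0r addr0 mul1r.
  have sp : 0 < s by rewrite lt_def sn.
  have : s * `|q - p| < s * e by rewrite ltr_pM2l.
  have : (1 - s) * `|q' - p| <= (1 - s) * e by rewrite ler_wpM2l ?subr_ge0 // ltW.
  lra.
have goods s : 0 <= s <= 1 -> U (q' + s *: (q - q')) /\
    ((forall j, `|'D_(delta_mx 0 j, 0) g (q' + s *: (q - q'))| <= M)
     /\ `|'D_(0, 1) g (q' + s *: (q - q'))| <= M).
  by move=> /seg hs; apply: good; rewrite /= distrC.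
have [s s01 E] : exists2 s, s \in `[0, 1]%R & g (q' + 1 *: (q - q')) - g (q' + 0 *: (q - q')) =
     'D_(q - q') g (q' + s *: (q - q')) * (1 - 0).
  apply: (@MVT_segment R (fun s => g (q' + s *: (q - q')))
     (fun s => 'D_(q - q') g (q' + s *: (q - q'))) 0 1) => //.
    move=> s /itvP hs; apply: is_derive_line; apply: dU.
    by apply: (goods _ _).1; rewrite !hs.
  apply: derivable_within_continuous => s /itvP hs.
  have := @is_derive_line R _ g q' (q - q') s.
  case=> //; apply: dU; apply: (goods _ _).1; rewrite !hs.
  by [].
move: E; rewrite scale1r scale0r addr0 subr0 mulr1 [q' + _]addrC subrK => ->.
move: s01; rewrite in_itv /= => /goods[hU [h1 h2]].
by apply: derive_pair_le => //; exact: dU.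
Qed.

(** Compactness makes the local constants uniform for pairs closer than 1/L. Any other pair
    satisfies 1 <= L |p - q|, so the trivial bound 2 |M| on the increment is itself at most 2 |M| L
    |p - q|. Convexity of [S] is replaced by this dichotomy. *)
Lemma compact_locally_lipschitz (R : realType) (W : normedModType R) (S : set W)
    (g : W -> R) (M : R) : compact S ->
  (forall p, S p -> `|g p| <= M) ->
  (forall p, S p -> exists L e : R, [/\ 0 <= L, 0 < e & forall q q',
    `|q - p| < e -> `|q' - p| < e -> `|g q - g q'| <= L * `|q - q'| ]) ->
  exists2 L : R, 0 <= L & forall p q, S p -> S q -> `|g p - g q| <= L * `|p - q|.
Proof.
move=> cS bS locS.
have : \forall L \near +oo, S `<=` (fun L p => forall q, `|q - p| < L^-1 ->
          `|g p - g q| <= L * `|p - q|) (L : R).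
  move/compact_near_coveringP : cS; apply => p0 Sp0.
  have [L0 [e [L0ge e0 hL]]] := locS _ Sp0.
  near=> p L => q qp.
  have Lbig : L0 <= L by near: L; apply: nbhs_pinfty_ge; exact: num_real.
  have L2e : 2 / e <= L by near: L; apply: nbhs_pinfty_ge; exact: num_real.
  have pp0 : `|p - p0| < e / 2.
    near: p; apply/nbhs_normP; exists (e / 2); first by rewrite /= divr_gt0.
    by move=> z /=; rewrite distrC.
  have Le : L^-1 <= e / 2.
    have L0' : 0 < L by apply: lt_le_trans L2e; rewrite divr_gt0.
    by rewrite -[leRHS]invrK lef_pV2 ?posrE ?invr_gt0 ?divr_gt0 // invf_div.
  apply: le_trans (hL p q _ _) _.
  - by apply: lt_le_trans pp0 _; lra.
  - rewrite -(subrK p q) -addrA (le_lt_trans (ler_normD _ _))//.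
    by have := lt_le_trans qp Le; lra.
  - by rewrite ler_wpM2r.
move=> hnear.
have [L [L0 hL]] : exists L : R, 0 < L /\ (S `<=` (fun L p => forall q,
    `|q - p| < L^-1 -> `|g p - g q| <= L * `|p - q|) L).
  near (pinfty_nbhs R) => L; exists L; split; last by near: L.
  by near: L; apply: nbhs_pinfty_gt; exact: num_real.
exists (L + 2 * `|M| * L) => [|p q Sp Sq].
  by rewrite addr_ge0 ?mulr_ge0 //; apply: ltW.
have [lt|ge] := ltP `|q - p| L^-1.
  rewrite (le_trans (hL _ Sp _ lt))// ler_wpM2r // lerDl !mulr_ge0 //; apply: ltW.
  by [].
have pq : 1 <= L * `|p - q|.
  by rewrite distrC -(@mulfV _ L) ?gt_eqF // ler_pM2l.
have : `|g p - g q| <= 2 * `|M|.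
  rewrite (le_trans (ler_normB _ _))//.
  by have := bS _ Sp; have := bS _ Sq; have := ler_norm M; lra.
move/le_trans; apply.
have : 2 * `|M| * 1 <= 2 * `|M| * (L * `|p - q|) by rewrite ler_wpM2l // mulr_ge0.
have : 0 <= L * `|p - q| by rewrite mulr_ge0 // ltW.
lra.
Unshelve. all: by end_near. Qed.

(** * Calculus of bounded Lipschitz maps *)

(** Boundedness is carried along with the Lipschitz bound because products preserve the pair but not
    the Lipschitz property alone. One constant serves for both. *)
Definition blip (R : realType) (W U : normedModType R) (S : set W) (phi : W -> U) :=
  exists2 M : R, 0 <= M & (forall p, S p -> `|phi p| <= M) /\
    (forall p q, S p -> S q -> `|phi p - phi q| <= M * `|p - q|).

Section BoundedLipschitz.
Variables (R : realType) (W : normedModType R) (S : set W).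

Lemma blip_eq (U : normedModType R) (f g : W -> U) :
  (forall p, S p -> f p = g p) -> blip S f -> blip S g.
Proof.
move=> fg [M M0 [b l]]; exists M => //; split=> [p Sp|p q Sp Sq].
  by rewrite -fg //; exact: b.
by rewrite -!fg //; exact: l.
Qed.

Lemma blip_cst (U : normedModType R) (u : U) : blip S (fun=> u).
Proof.
exists `|u| => //; split=> // p q _ _.
by rewrite subrr normr0 mulr_ge0.
Qed.

Lemma blipD (U : normedModType R) (f g : W -> U) :
  blip S f -> blip S g -> blip S (fun p => f p + g p).
Proof.
move=> [M M0 [bf lf]] [N N0 [bg lg]]; exists (M + N); first exact: addr_ge0.
split=> [p Sp|p q Sp Sq].
  by rewrite (le_trans (ler_normD _ _))// lerD // ?bf ?bg.
rewrite opprD addrACA (le_trans (ler_normD _ _))// mulrDl lerD //.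
  exact: lf.
exact: lg.
Qed.

Lemma blipZ (U : normedModType R) (a : W -> R) (f : W -> U) :
  blip S a -> blip S f -> blip S (fun p => a p *: f p).
Proof.
move=> [M M0 [ba la]] [N N0 [bf lf]].
exists (2 * (M * N) + M * N) => [|]; first by rewrite addr_ge0 ?mulr_ge0.
split=> [p Sp|p q Sp Sq].
  rewrite normrZ.
  have : `|a p| * `|f p| <= M * N by rewrite ler_pM // ?ba ?bf.
  have : 0 <= M * N by rewrite mulr_ge0.
  lra.
have -> : a p *: f p - a q *: f q = a p *: (f p - f q) + (a p - a q) *: f q.
  by rewrite scalerBr scalerBl addrA subrK.
rewrite (le_trans (ler_normD _ _))// !normrZ.
have : `|a p| * `|f p - f q| <= M * (N * `|p - q|) by rewrite ler_pM // ?ba ?lf.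
have : `|a p - a q| * `|f q| <= M * `|p - q| * N by rewrite ler_pM // ?la ?bf.
have : 0 <= M * N * `|p - q| by rewrite !mulr_ge0.
lra.
Qed.

Lemma blipM (a b : W -> R) :
  blip S a -> blip S b -> blip S (fun p => a p * b p).
Proof. exact: blipZ. Qed.

Lemma blipN (U : normedModType R) (f : W -> U) :
  blip S f -> blip S (fun p => - f p).
Proof.
move=> hf; apply: (blip_eq _ (blipZ (blip_cst (-1 : R)) hf)) => p _.
by rewrite scaleN1r.
Qed.

Lemma blipB (U : normedModType R) (f g : W -> U) :
  blip S f -> blip S g -> blip S (fun p => f p - g p).
Proof. by move=> hf hg; apply: blipD => //; exact: blipN. Qed.

Lemma blip_sum (U : normedModType R) (I : finType) (f : I -> W -> U) :
  (forall i, blip S (f i)) -> blip S (fun p => \sum_i f i p).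
Proof.
move=> hf; elim: (index_enum I) => [|i s IH].
  by apply: (blip_eq _ (blip_cst (0 : U))) => p _; rewrite big_nil.
by apply: (blip_eq _ (blipD (hf i) IH)) => p _; rewrite big_cons.
Qed.

(** [gam] is controlled only on the values that [a] takes; its boundedness comes from comparison
    with one base point, the case of empty [S] being trivial. *)
Lemma blip_comp (D : set R) (L : R) (gam : R -> R) (a : W -> R) :
  (forall c d, D c -> D d -> `|gam c - gam d| <= L * `|c - d|) ->
  (forall p, S p -> D (a p)) -> blip S a -> blip S (fun p => gam (a p)).
Proof.
move=> hg aD [M M0 [ba la]].
have [[p0 Sp0]|nS] := pselect (exists p, S p); last first.
  by exists 0 => //; split=> [p Sp|p q Sp]; exfalso; apply: nS; exists p.
have hL c d : D c -> D d -> `|gam c - gam d| <= `|L| * `|c - d|.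
  by move=> Dc Dd; rewrite (le_trans (hg _ _ Dc Dd)) // ler_wpM2r // ler_norm.
exists (`|gam (a p0)| + `|L| * (2 * M) + `|L| * M).
  by rewrite !addr_ge0 // !mulr_ge0.
have LM : 0 <= `|L| * M by rewrite mulr_ge0.
split=> [p Sp|p q Sp Sq].
  have := hL _ _ (aD _ Sp) (aD _ Sp0).
  have : `|L| * `|a p - a p0| <= `|L| * (2 * M).
    rewrite ler_wpM2l // (le_trans (ler_normB _ _))//.
    by have := ba _ Sp; have := ba _ Sp0; lra.
  have := ler_normD (gam (a p) - gam (a p0)) (gam (a p0)).
  by rewrite subrK; lra.
rewrite (le_trans (hL _ _ (aD _ Sp) (aD _ Sq)))//.
rewrite mulrDl ler_wpDl // ?mulr_ge0 ?addr_ge0 ?mulr_ge0 //.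
by rewrite -mulrA ler_wpM2l // la.
Qed.

Lemma blipV (a : W -> R) (d : R) : 0 < d -> (forall p, S p -> d <= a p) ->
  blip S a -> blip S (fun p => (a p)^-1).
Proof.
move=> d0 da; apply: (@blip_comp [set c | d <= c] (d^-1 * d^-1)) => //= c e dc de.
have c0 := lt_le_trans d0 dc; have e0 := lt_le_trans d0 de.
have -> : c^-1 - e^-1 = (c^-1 * e^-1) * (e - c).
  by field; rewrite !gt_eqF.
have ci : 0 <= c^-1 by rewrite invr_ge0 ltW.
have ei : 0 <= e^-1 by rewrite invr_ge0 ltW.
rewrite normrM distrC ler_wpM2r // ger0_norm ?mulr_ge0 //.
by rewrite ler_pM // lef_pV2.
Qed.

Lemma blip_coord (m : nat) (f : W -> 'rV[R]_m) j :
  blip S f -> blip S (fun p => f p 0 j).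
Proof.
move=> [M M0 [b l]]; exists M => //; split=> [p Sp|p q Sp Sq].
  exact: le_trans (rV_coord_le _ _) (b _ Sp).
apply: le_trans (l _ _ Sp Sq); have := rV_coord_le (f p - f q) j.
by rewrite !mxE.
Qed.

Lemma blip_einner (m : nat) (f g : W -> 'rV[R]_m) :
  blip S f -> blip S g -> blip S (fun p => einner (f p) (g p)).
Proof.
by move=> hf hg; apply: blip_sum => j; apply: blipM; exact: blip_coord.
Qed.

Lemma blip_linner (m : nat) (f g : W -> 'rV[R]_m) :
  blip S f -> blip S g -> blip S (fun p => linner (f p) (g p)).
Proof.
move=> hf hg; apply: blip_sum => j; apply: blipM; last exact: blip_coord.
by apply: blipM; [exact: blip_cst | exact: blip_coord].
Qed.

End BoundedLipschitz.

(** * Error propagation and Taylor bounds along the exact solution *)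

(** The induction bound C h^2 i (1 + a h)^i is a crude majorant of the geometric sum. It avoids a
    division by [a], which may be 0; then i h <= T and 1 + a h <= exp(a h) conclude. *)
Lemma discrete_gronwall (R : realType) (e : nat -> R) (a C h T : R) (N : nat) :
  0 <= a -> 0 <= C -> 0 <= h -> N%:R * h <= T -> e 0%N = 0 ->
  (forall j, (j < N)%N -> e j.+1 <= (1 + a * h) * e j + C * h ^+ 2) ->
  forall j, (j <= N)%N -> e j <= C * T * expR (a * T) * h.
Proof.
move=> a0 C0 h0 hN e0 he j jN.
have ah0 : 0 <= a * h by rewrite mulr_ge0.
have T0 : 0 <= T by apply: le_trans hN; rewrite mulr_ge0.
have B i : (i <= N)%N -> e i <= C * h ^+ 2 * i%:R * (1 + a * h) ^+ i.
  elim: i => [|i IH] iN; first by rewrite e0 mulr0 mul0r.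
  apply: le_trans (he _ iN) _.
  have ge1 : 1 <= (1 + a * h) ^+ i.+1 by rewrite exprn_ege1 // lerDl.
  have : (1 + a * h) * e i <= (1 + a * h) * (C * h ^+ 2 * i%:R * (1 + a * h) ^+ i).
    by rewrite ler_wpM2l ?addr_ge0 // IH // ltnW.
  have : C * h ^+ 2 * 1 <= C * h ^+ 2 * (1 + a * h) ^+ i.+1.
    by rewrite ler_wpM2l // mulr_ge0 // sqr_ge0.
  rewrite -[i.+1%:R]natr1 (exprS _ i); move: (_ ^+ i) => P; lra.
apply: le_trans (B _ jN) _.
have jh : j%:R * h <= T.
  by apply: le_trans hN; rewrite ler_wpM2r // ler_nat.
have pw : (1 + a * h) ^+ j <= expR (a * T).
  apply: (@le_trans _ _ (expR (a * h) ^+ j)).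
    by rewrite lerXn2r ?nnegrE ?addr_ge0 ?expR_ge0 // expR_ge1Dx.
  by rewrite -expRM_natl ler_expR mulrCA ler_wpM2l.
have -> : C * h ^+ 2 * j%:R * (1 + a * h) ^+ j
  = C * (j%:R * h) * (1 + a * h) ^+ j * h by ring.
rewrite ler_wpM2r // ler_pM ?mulr_ge0 ?exprn_ge0 ?addr_ge0 //.
by rewrite ler_wpM2l.
Qed.

Section ExactSolution.
Variables (R : realType) (m : nat) (x G : R -> 'rV[R]_m) (T : R).
Hypothesis xcont : {within `[0, T], continuous x}.
Hypothesis xder : forall t, 0 < t < T -> derivable x t 1 /\ 'D_1 x t = G t.

(** The mean value theorem holds coordinate by coordinate, with a time [r] depending on [j]. The sup
    norm makes this sufficient for vector estimates. *)
Lemma coord_mean_value s t j : 0 <= s -> s <= t -> t <= T ->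
  exists2 r, s <= r <= t & x t 0 j - x s 0 j = G r 0 j * (t - s).
Proof.
move=> s0 st tT.
have := @MVT_segment R (fun t => x t 0 j) (fun r => G r 0 j) s t st.
case.
- move=> r /itvP hr.
  have [|dx <-] := xder (t := r).
    by rewrite (le_lt_trans s0) ?hr // (lt_le_trans _ tT) ?hr.
  split; first by move/derivable_mxP : dx; apply.
  by rewrite derive_mx // mxE.
- have xst : {within `[s, t], continuous x}.
    apply: continuous_subspaceW xcont => r /=; rewrite !in_itv /=.
    by move=> /andP[sr rt]; rewrite (le_trans s0 sr) (le_trans rt tT).
  move=> r; apply: (@continuous_comp (subspace `[s, t]) _ _ x
    (fun v : 'rV[R]_m => v 0 j)); first exact: xst.
  exact: coord_continuous.
- by move=> r; rewrite in_itv /= => hr E; exists r.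
Qed.

Lemma solution_lipschitz (M : R) :
  (forall t, 0 <= t <= T -> `|G t| <= M) ->
  forall s t, 0 <= s -> s <= t -> t <= T -> `|x t - x s| <= M * (t - s).
Proof.
move=> GM s t s0 st tT.
have M0 : 0 <= M.
  by apply: le_trans (GM s _) => //; rewrite s0 (le_trans st).
apply: rV_norm_le => [|j]; first by rewrite mulr_ge0 ?subr_ge0.
have [r /andP[sr rt] E] := coord_mean_value j s0 st tT.
rewrite !mxE E normrM [`|t - s|]ger0_norm ?subr_ge0 // ler_wpM2r ?subr_ge0 //.
apply: le_trans (rV_coord_le _ _) (GM r _).
by rewrite (le_trans s0) // (le_trans rt).
Qed.

(** By the mean value theorem each coordinate of the residual is (G r - G s)(t - s) for some
    intermediate [r], so a Lipschitz bound on [G] replaces a second derivative of the solution. *)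
Lemma solution_euler_error (L : R) :
  (forall s t, 0 <= s -> s <= t -> t <= T -> `|G t - G s| <= L * (t - s)) ->
  forall s t, 0 <= s -> s <= t -> t <= T ->
    `|x t - x s - (t - s) *: G s| <= `|L| * (t - s) ^+ 2.
Proof.
move=> GL s t s0 st tT.
apply: rV_norm_le => [|j]; first by rewrite mulr_ge0 ?sqr_ge0.
have [r /andP[sr rt] E] := coord_mean_value j s0 st tT.
have -> : (x t - x s - (t - s) *: G s) 0 j = (G r - G s) 0 j * (t - s).
  by rewrite !mxE E; ring.
rewrite normrM [`|t - s|]ger0_norm ?subr_ge0 // expr2 mulrA.
rewrite ler_wpM2r ?subr_ge0 //.
apply: le_trans (rV_coord_le _ _) _.
apply: le_trans (GL _ _ s0 sr (le_trans rt tT)) _.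
apply: (@le_trans _ _ (`|L| * (r - s))).
  by rewrite ler_wpM2r ?subr_ge0 // ler_norm.
by rewrite ler_wpM2l // lerD2r.
Qed.

End ExactSolution.

(** * Circular and hyperbolic functions treated together *)

(* [eps] is the sign of the curvature: [cos, sin] for [eps = 1] and
   [cosh, sinh] for [eps = -1]. *)
Record trig_pair (R : realType) (eps : R) (C S : R -> R) := TrigPair {
  trig_dC : forall a : R, is_derive a 1 C (- eps * S a);
  trig_dS : forall a : R, is_derive a 1 S (C a);
  trig_C0 : C 0 = 1;
  trig_S0 : S 0 = 0;
  trig_CB : forall a b, C (a - b) = C a * C b + eps * (S a * S b);
  trig_SB : forall a b, S (a - b) = S a * C b - C a * S b;
  trig_bd : forall A, exists B : R, forall a, 0 <= a <= A -> `|C a| <= B;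
  trig_eps : `|eps| = 1 }.

Section TrigPair.
Variables (R : realType) (eps : R) (C S : R -> R).
Hypothesis trig : trig_pair eps C S.

Lemma trig_sqr a : C a ^+ 2 + eps * S a ^+ 2 = 1.
Proof. by rewrite -(trig_C0 trig) -(subrr a) (trig_CB trig) !expr2. Qed.

Lemma trig_epsK : eps * eps = 1.
Proof. by rewrite -expr2 -real_normK ?num_real // (trig_eps trig) expr1n. Qed.

Lemma trig_mean_S a b : a <= b ->
  exists2 c, c \in `[a, b]%R & S b - S a = C c * (b - a).
Proof.
move=> ab; apply: MVT_segment => // [t _|]; first exact: trig_dS trig t.
by apply: derivable_within_continuous => t _; have [] := trig_dS trig t.
Qed.

Lemma trig_mean_C a b : a <= b ->
  exists2 c, c \in `[a, b]%R & C b - C a = - eps * S c * (b - a).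
Proof.
move=> ab; apply: (@MVT_segment R C (fun c => - eps * S c)) => // [t _|].
  exact: trig_dC trig t.
by apply: derivable_within_continuous => t _; have [] := trig_dC trig t.
Qed.

(** The mean value theorem is applied three times: S is O(a), hence C - 1 is O(a^2), hence S - a is
    O(a^3), in which one factor a is absorbed by [A]. *)
Lemma trig_taylor (A : R) : 0 <= A -> exists2 M : R, 0 <= M &
  forall a, 0 <= a <= A -> `|C a - 1| <= M * a ^+ 2 /\ `|S a - a| <= M * a ^+ 2.
Proof.
move=> A0; have [B hB] := trig_bd trig A.
have B0 : 0 <= B by apply: le_trans (hB 0 _) => //; rewrite lexx.
have hS a : 0 <= a <= A -> `|S a| <= B * a.
  move=> /andP[a0 aA]; have [c] := trig_mean_S a0.
  rewrite in_itv /= (trig_S0 trig) !subr0 => /andP[c0 ca] ->.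
  by rewrite normrM (ger0_norm a0) ler_wpM2r // hB // c0 (le_trans ca).
have hC a : 0 <= a <= A -> `|C a - 1| <= B * a ^+ 2.
  move=> /andP[a0 aA]; have [c] := trig_mean_C a0.
  rewrite in_itv /= (trig_C0 trig) subr0 => /andP[c0 ca] ->.
  rewrite !normrM normrN (trig_eps trig) mul1r (ger0_norm a0) expr2 mulrA.
  rewrite ler_wpM2r // (le_trans (hS c _)) ?c0 ?(le_trans ca) //.
  by rewrite ler_wpM2l.
exists (B + B * A); first by rewrite addr_ge0 // mulr_ge0.
move=> a /andP[a0 aA]; split.
  apply: le_trans (hC a _) _; first by rewrite a0.
  by rewrite ler_wpM2r ?sqr_ge0 // lerDl mulr_ge0.
have [c] := trig_mean_S a0.
rewrite in_itv /= (trig_S0 trig) !subr0 => /andP[c0 ca] ->.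
have -> : C c * a - a = (C c - 1) * a by ring.
rewrite normrM (ger0_norm a0).
apply: (@le_trans _ _ (B * A ^+ 1 * a ^+ 2)).
  rewrite expr1 expr2 !mulrA ler_wpM2r // (le_trans (hC c _)) //.
    by rewrite c0 (le_trans ca).
  by rewrite -mulrA ler_wpM2l // expr2 ler_pM // (le_trans ca).
by rewrite ler_wpM2r ?sqr_ge0 // expr1 lerDr.
Qed.

(** The value 1 at 0 is the limit of a / S a; division by [S 0] would give 0. *)
Definition angle_ratio (a : R) : R := if a == 0 then 1 else a / S a.

(** * Lipschitz dependence of the ratio angle/sine on the cosine *)

Section AngleRatio.
Variables (Th : set R) (Gm d : R).
Hypothesis d0 : 0 < d.
Hypothesis Th_down : forall a b, 0 <= a -> a <= b -> Th b -> Th a.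
Hypothesis Th_between : forall a b, 0 <= a -> a <= b -> Th b ->
  (1 <= C a <= C b) || (C b <= C a <= 1).
Hypothesis Th_S : forall a, Th a -> 0 < a -> 0 < S a.
Hypothesis Th_G : forall a, Th a -> 0 < a -> a <= Gm * S a.
Hypothesis Th_d : forall a, Th a -> d <= 1 + C a.

(** By the mean value theorem S a = a C c for some c between 0 and a, and C c lies between 1 and C a
    because [C] is monotone on admissible angles. *)
Lemma S_near_angle a : 0 <= a -> Th a ->
  `|S a - a| <= a * `|C a - 1| /\ `|S a - a * C a| <= a * `|C a - 1|.
Proof.
move=> a0 Ta; have [c] := trig_mean_S a0.
rewrite in_itv /= (trig_S0 trig) !subr0 => /andP[c0 ca] ->.
have -> : C c * a - a = a * (C c - 1) by ring.
have -> : C c * a - a * C a = a * (C c - C a) by ring.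
rewrite !normrM (ger0_norm a0).
have := Th_between c0 ca Ta => /orP[] /andP[h1 h2]; split; rewrite ler_wpM2l //.
- by rewrite !ger0_norm ?subr_ge0 //; lra.
- by rewrite distrC !ger0_norm ?subr_ge0 //; lra.
- by rewrite distrC [leRHS]distrC !ger0_norm ?subr_ge0 //; lra.
- by rewrite [leRHS]distrC !ger0_norm ?subr_ge0 //; lra.
Qed.

(** The quotient is the derivative of a / S a. Its numerator is at most a |C a - 1|, where |C a - 1|
    (1 + C a) = S a ^ 2 and 1 + C a >= d, while a <= Gm S a. One factor S a survives, and it is the
    absolute value of the derivative of [C]: exactly what a comparison with increments of [C]
    requires. *)
Lemma angle_ratio_dbound a : 0 < a -> Th a ->
  `|(S a - a * C a) / S a ^+ 2| <= Gm / d * S a.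
Proof.
move=> a0 Ta; have Sa := Th_S Ta a0.
have [_ h] := S_near_angle (ltW a0) Ta.
have E : `|C a - 1| * (1 + C a) = S a ^+ 2.
  have e1 : (1 - C a) * (1 + C a) = eps * S a ^+ 2 by have := trig_sqr a; lra.
  have c1 : 0 < 1 + C a by apply: lt_le_trans d0 (Th_d Ta).
  rewrite distrC -[X in _ * X]ger0_norm ?(ltW c1) // -normrM e1 normrM.
  by rewrite (trig_eps trig) mul1r ger0_norm // sqr_ge0.
have hc : `|C a - 1| * d <= S a ^+ 2.
  by rewrite -E ler_wpM2l // Th_d.
rewrite normrM [`|_^-1|]ger0_norm ?invr_ge0 ?sqr_ge0 //.
rewrite ler_pdivrMr ?exprn_gt0 //; apply: le_trans h _.
have hG := Th_G Ta a0.
have -> : Gm / d * S a * S a ^+ 2 = Gm * S a * (S a ^+ 2 / d) by field; rewrite gt_eqF.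
rewrite ler_pM ?(ltW a0) //.
by rewrite ler_pdivlMr.
Qed.

Lemma is_derive_angle_ratio a : S a != 0 ->
  is_derive a 1 (fun s => s / S s) ((S a - a * C a) / S a ^+ 2).
Proof.
move=> Sa; have dS := trig_dS trig a.
have dV : is_derive a 1 (fun s => (S s)^-1) (- (S a) ^- 2 * C a).
  exact: is_deriveV.
apply: is_derive_eq.
rewrite /GRing.scale /=; field.
by [].
Qed.

(* Cauchy's mean value theorem for the pair [a / S a], [C a]. *)
Lemma angle_ratio_lipschitz : exists2 L : R, 0 <= L & forall a b,
  0 <= a -> 0 <= b -> Th a -> Th b ->
  `|angle_ratio a - angle_ratio b| <= L * `|C a - C b|.
Proof.
exists (`|Gm| + `|Gm| / d) => [|].
  by rewrite addr_ge0 // divr_ge0 // ltW.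
have L0 : 0 <= `|Gm| / d by rewrite divr_ge0 // ltW.
suff W a b : 0 <= a -> a < b -> Th b ->
    `|angle_ratio a - angle_ratio b| <= (`|Gm| + `|Gm| / d) * `|C a - C b|.
  move=> a b a0 b0 Ta Tb; case: (ltgtP a b) => [ab|ba|->].
  - exact: W.
  - by rewrite distrC [`|C a - _|]distrC; exact: W.
  - by rewrite !subrr normr0 mulr0.
move=> a0 ab Tb; have b0 := le_lt_trans a0 ab.
have Sb := Th_S Tb b0.
(* The endpoint 0 is separated because there [angle_ratio] is a prescribed value and s / S s is not
   continuous under the convention for division by zero. *)
have [->|an0] := eqVneq a 0.
  rewrite /angle_ratio eqxx gt_eqF // (trig_C0 trig).
  have [h _] := S_near_angle (ltW b0) Tb.
  have -> : 1 - b / S b = (S b - b) / S b by field; rewrite gt_eqF.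
  rewrite normrM [`|_^-1|]ger0_norm ?invr_ge0 ?(ltW Sb) // ler_pdivrMr //.
  apply: le_trans h _; rewrite [`|1 - _|]distrC mulrAC ler_wpM2r //.
  apply: le_trans (Th_G Tb b0) _; rewrite ler_wpM2r ?(ltW Sb) //.
  by apply: le_trans (ler_norm _) _; rewrite lerDl.
have apos : 0 < a by rewrite lt_def an0.
have Ta := Th_down a0 (ltW ab) Tb.
pose G s := s / S s.
rewrite /angle_ratio !gt_eqF // -/(G a) -/(G b).
pose dphi s := (G b - G a) * (- eps * S s)
               - (C b - C a) * ((S s - s * C s) / S s ^+ 2).
have TS s : a <= s <= b -> 0 < S s /\ Th s.
  move=> /andP[as_ sb].
  have Ts : Th s by apply: Th_down Tb => //; exact: le_trans a0 as_.
  by split=> //; apply: Th_S => //; exact: lt_le_trans apos as_.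
have dphiP s : a <= s <= b ->
    is_derive s 1 (fun s => (G b - G a) * C s - (C b - C a) * G s) (dphi s).
  move=> /TS[Ss _]; have dC := trig_dC trig s.
  have dG : is_derive s 1 G ((S s - s * C s) / S s ^+ 2).
    by apply: is_derive_angle_ratio; rewrite gt_eqF.
  apply: is_derive_eq.
  by rewrite /dphi /GRing.scale /=; ring.
have [s sab] : exists2 s, s \in `]a, b[%R &
    ((G b - G a) * C b - (C b - C a) * G b) - ((G b - G a) * C a - (C b - C a) * G a)
    = dphi s * (b - a).
  apply: (@MVT R (fun s => (G b - G a) * C s - (C b - C a) * G s) dphi a b ab).
    by move=> s /itvP hs; apply: dphiP; rewrite !hs.
  apply: derivable_within_continuous => s /itvP hs.
  by have [] := dphiP s; rewrite ?hs.
have -> : ((G b - G a) * C b - (C b - C a) * G b)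
   - ((G b - G a) * C a - (C b - C a) * G a) = 0 by ring.
move=> /esym/eqP; rewrite mulf_eq0 [b - a == 0]subr_eq0 (gt_eqF ab) orbF /dphi.
rewrite subr_eq0 => /eqP E.
have asb : a <= s <= b by move: sab => /itvP hs; rewrite !hs.
have [Ss Ts] := TS s asb.
have sp : 0 < s by case/andP: asb => /(lt_le_trans apos).
have : `|G b - G a| * S s <= `|C b - C a| * (Gm / d * S s).
  have -> : `|G b - G a| * S s = `|(G b - G a) * (- eps * S s)|.
    by rewrite !normrM normrN (trig_eps trig) mul1r (gtr0_norm Ss).
  by rewrite E normrM ler_wpM2l // angle_ratio_dbound.
rewrite mulrA ler_pM2r // distrC [`|C a - _|]distrC => /le_trans; apply.
rewrite mulrC ler_wpM2r //.
apply: (@le_trans _ _ (`|Gm| / d)); last by rewrite lerDr.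
by rewrite ler_wpM2r ?invr_ge0 ?(ltW d0) // ler_norm.
Qed.

End AngleRatio.
End TrigPair.

(** * The two instances, and the inverse functions *)

Lemma cos_sin_trig_pair (R : realType) : trig_pair (1 : R) cos sin.
Proof.
split=> [a|a|||a b|a b|A|].
- by apply: is_derive_eq; rewrite mulN1r.
- exact: is_derive_sin.
- exact: cos0.
- exact: sin0.
- by rewrite cosB mul1r.
- exact: sinB.
- by exists 1 => a _; rewrite ler_norml cos_geN1 cos_le1.
- exact: normr1.
Qed.

Lemma cosh_sinh_trig_pair (R : realType) : trig_pair (-1 : R) (@coshR R) (@sinhR R).
Proof.
split=> [a|a|||a b|a b|A|].
- rewrite /coshR /sinhR; apply: is_derive_eq.
  by rewrite /GRing.scale /=; ring.
- rewrite /coshR /sinhR; apply: is_derive_eq.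
  by rewrite /GRing.scale /=; ring.
- by rewrite /coshR oppr0 expR0 -mulr2n -mulr_natr mul1r divff.
- by rewrite /sinhR oppr0 expR0 subrr mul0r.
- by rewrite /coshR /sinhR opprB [b - a]addrC !expRD; field.
- by rewrite /coshR /sinhR opprB [b - a]addrC !expRD; field.
- exists (expR A + expR A) => a /andP[a0 aA]; rewrite /coshR.
  rewrite ger0_norm ?divr_ge0 ?addr_ge0 ?expR_ge0 //.
  have : expR a <= expR A by rewrite ler_expR.
  have : expR (- a) <= expR A by rewrite ler_expR; lra.
  have := expR_ge0 A; lra.
- by rewrite normrN normr1.
Qed.

Lemma mulr_cos_le_sin (R : realType) (a : R) : 0 <= a -> a <= pi -> a * cos a <= sin a.
Proof.
move=> a0 api; have [c] := trig_mean_S (cos_sin_trig_pair R) a0.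
rewrite in_itv /= sin0 !subr0 => /andP[c0 ca] ->.
rewrite mulrC ler_wpM2r //; move: ca; rewrite le_eqVlt => /predU1P[->//|ca].
by rewrite ltW // ltr_cos // in_itv /= ?a0 ?c0 ?api //= (le_trans (ltW ca)).
Qed.

Lemma acos_ratio_lipschitz (R : realType) (d : R) : 0 < d ->
  exists2 L : R, 0 <= L & forall b c, d - 1 <= b <= 1 -> d - 1 <= c <= 1 ->
    `|angle_ratio sin (acos b) - angle_ratio sin (acos c)| <= L * `|b - c|.
Proof.
move=> d0.
pose Th : set R := [set a | [/\ 0 <= a, a < pi & d <= 1 + cos a]].
have cos_mono (a b : R) : 0 <= a -> a <= b -> b < pi -> cos b <= cos a.
  move=> a0; rewrite le_eqVlt => /predU1P[->//|ab] bpi.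
  rewrite ltW // ltr_cos // in_itv /= ?a0 ?(ltW bpi) ?(le_trans a0 (ltW ab)) //.
  by rewrite (le_trans (ltW ab) (ltW bpi)).
(* The constant bounding a / sin a adds two cases. If cos a >= 1/2, then a <= 2 sin a. Otherwise sin
   a >= sin^2 a = (1 - cos a)(1 + cos a) >= d/2, so that a <= pi <= (2 pi / d) sin a. *)
have [] := @angle_ratio_lipschitz R 1 cos sin (cos_sin_trig_pair R) Th
   (2 + 2 * pi / d) d d0.
- move=> a b a0 ab [b0 bpi db]; split=> //; first exact: le_lt_trans bpi.
  by apply: le_trans db _; rewrite lerD2l cos_mono.
- by move=> a b a0 ab [b0 bpi db]; apply/orP; right; rewrite cos_le1 cos_mono.
- by move=> a [a0 api _] ap; rewrite sin_gt0_pi // ap.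
- move=> a [a0 api da] ap.
  have sp : 0 < sin a by rewrite sin_gt0_pi // ap.
  have pd : 0 <= 2 * pi / d * sin a.
    by rewrite !mulr_ge0 ?invr_ge0 ?pi_ge0 ?(ltW sp) ?(ltW d0).
  have [ge|lt] := leP 2^-1 (cos a).
    have := mulr_cos_le_sin a0 (ltW api).
    have : a * 2^-1 <= a * cos a by rewrite ler_wpM2l.
    lra.
  have s2 : sin a ^+ 2 = (1 - cos a) * (1 + cos a) by rewrite sin2cos2; ring.
  have : sin a ^+ 2 <= sin a.
    by rewrite expr2 ler_piMl ?(ltW sp) // sin_le1.
  have : 2^-1 * d <= sin a ^+ 2.
    by rewrite s2 ler_pM ?(ltW d0) //; lra.
  move=> h1 h2.
  have : 2 * pi / d * (2^-1 * d) <= 2 * pi / d * sin a.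
    rewrite ler_wpM2l ?(le_trans h1) //.
    by rewrite !mulr_ge0 ?invr_ge0 ?pi_ge0 ?(ltW d0).
  have -> : 2 * pi / d * (2^-1 * d) = pi by field; rewrite gt_eqF.
  lra.
- by move=> a [].
move=> L L0 hL; exists L => // b c hb hc.
have inTh u : d - 1 <= u <= 1 -> [/\ 0 <= acos u, Th (acos u) & cos (acos u) = u].
  move=> /andP[u1 u2].
  have hu : -1 <= u <= 1 by rewrite u2 andbT; lra.
  have cu : cos (acos u) = u by rewrite acosK // in_itv.
  split=> //; first exact: acos_ge0.
  split; [exact: acos_ge0| |by rewrite cu; lra].
  by apply: acos_ltpi; rewrite u2 andbT; lra.
have [b0 Tb cb] := inTh b hb; have [c0 Tc cc] := inTh c hc.
by have := hL _ _ b0 c0 Tb Tc; rewrite cb cc.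
Qed.

Section Acosh.
Variable R : realType.

Lemma acosh_props (c : R) : 1 <= c ->
  0 <= acoshR c /\ coshR (acoshR c) = c.
Proof.
move=> c1; rewrite /acoshR; set w := Num.sqrt _.
have w0 : 0 <= w by exact: sqrtr_ge0.
have w2 : w ^+ 2 = c ^+ 2 - 1.
  by rewrite sqr_sqrtr // subr_ge0 exprn_ege1.
have cw : 0 < c + w by lra.
have e1 : expR (ln (c + w)) = c + w by rewrite lnK.
have e2 : expR (- ln (c + w)) = c - w.
  rewrite expRN e1; apply: (mulfI (lt0r_neq0 cw)).
  rewrite mulfV ?gt_eqF //.
  by rewrite [RHS]mulrC -subr_sqr w2; ring.
split; first by rewrite ln_ge0 //; lra.
by rewrite /coshR e1 e2; field.
Qed.

Lemma sinh_ge_id (a : R) : 0 <= a -> a <= sinhR a.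
Proof.
move=> a0; have [c] := trig_mean_S (cosh_sinh_trig_pair R) a0.
rewrite in_itv /= (trig_S0 (cosh_sinh_trig_pair R)) !subr0 => /andP[c0 ca] ->.
rewrite ler_peMl // /coshR.
have := expR_ge1Dx c; have := expR_ge1Dx (- c); lra.
Qed.

(** Every angle is admissible and both constants are 1, since sinh a >= a for a >= 0 and cosh a >=
    1. *)
Lemma acosh_ratio_lipschitz : exists2 L : R, 0 <= L & forall b c : R, 1 <= b -> 1 <= c ->
    `|angle_ratio (@sinhR R) (acoshR b) - angle_ratio (@sinhR R) (acoshR c)|
      <= L * `|b - c|.
Proof.
have cosh1 (a : R) : 1 <= coshR a.
  by rewrite /coshR; have := expR_ge1Dx a; have := expR_ge1Dx (- a); lra.
have [] := @angle_ratio_lipschitz R (-1) (@coshR R) (@sinhR R) (cosh_sinh_trig_pair R)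
   setT 1 1 ltr01.
- by [].
- move=> a b a0 ab _; rewrite cosh1 /=.
  have [c] := trig_mean_C (cosh_sinh_trig_pair R) ab.
  rewrite in_itv /= opprK mul1r => /andP[ac cb] E.
  have c0 := le_trans a0 ac.
  suff h : 0 <= sinhR c * (b - a) by apply/orP; left; lra.
  by rewrite mulr_ge0 ?subr_ge0 // (le_trans c0) // sinh_ge_id.
- by move=> a _ a0; rewrite (lt_le_trans a0) // sinh_ge_id // ltW.
- by move=> a _ a0; rewrite mul1r sinh_ge_id // ltW.
- by move=> a _; rewrite lerDl (le_trans _ (cosh1 a)).
move=> L L0 hL; exists L => // b c /acosh_props[b0 cb] /acosh_props[c0 cc].
by have := hL _ _ b0 c0 I I; rewrite cb cc.
Qed.

End Acosh.

(** * Exponential, logarithm and transport on a quadric B x x = kappa *)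

Section CurvedFactor.
Variables (R : realType) (m : nat) (B : 'rV[R]_m -> 'rV[R]_m -> R).
Hypothesis B_sym : forall u v, B u v = B v u.
Hypothesis B_lin : forall u (a : R) v w, B u (a *: v + w) = a * B u v + B u w.
Hypothesis B_le : forall u v, `|B u v| <= m%:R * `|u| * `|v|.
Hypothesis B_blip : forall (W : normedModType R) (S : set W) (f g : W -> 'rV[R]_m),
  blip S f -> blip S g -> blip S (fun p => B (f p) (g p)).
Variables (eps rho : R) (C S A : R -> R).
Hypothesis trig : trig_pair eps C S.
Hypothesis rho0 : 0 < rho.
Let kappa := eps * rho ^+ 2.
Variable Mo : set 'rV[R]_m.
Hypothesis Mo_kappa : forall x, Mo x -> B x x = kappa.
Hypothesis Mo_pos : forall x v, Mo x -> B x v = 0 -> 0 <= B v v.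
Hypothesis Mo_def : forall x v, Mo x -> B x v = 0 -> B v v = 0 -> v = 0.

Let tn v := Num.sqrt (B v v).
(** The three formulas cover both curved models without a test for the zero vector: there the second
    coefficient multiplies 0 and C 0 = 1. With kappa negative the signs in [curved_log] and
    [curved_pt] turn into those of the Lorentz model. *)
Definition curved_exp x v : 'rV[R]_m :=
  C (tn v / rho) *: x + (rho * S (tn v / rho) / tn v) *: v.
Definition curved_log x y : 'rV[R]_m :=
  let u := y - (B x y / kappa) *: x in (rho * A (B x y / kappa) / tn u) *: u.
Definition curved_pt x y v : 'rV[R]_m :=
  v - (B y v / (kappa + B x y)) *: (x + y).

Let eps0 : eps != 0.
Proof. by rewrite -normr_eq0 (trig_eps trig) oner_eq0. Qed.

Let kappa0 : kappa != 0.
Proof. by rewrite mulf_neq0 // expf_neq0 // gt_eqF. Qed.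

Let epsK : eps * eps = 1. Proof. exact: trig_epsK trig. Qed.

Lemma form0 u : B u 0 = 0.
Proof.
apply/eqP; rewrite -normr_le0; apply: le_trans (B_le u 0) _.
by rewrite normr0 mulr0.
Qed.

Lemma formZ u a v : B u (a *: v) = a * B u v.
Proof. by have := B_lin u a v 0; rewrite addr0 form0 addr0. Qed.

Lemma formZZ a v : B (a *: v) (a *: v) = a ^+ 2 * B v v.
Proof. by rewrite formZ B_sym formZ mulrA -expr2. Qed.

Lemma formBZ u v a w : B u (v - a *: w) = B u v - a * B u w.
Proof. by rewrite addrC -scaleNr B_lin mulNr addrC. Qed.

Lemma curved_exp0 x : curved_exp x 0 = x.
Proof.
rewrite /curved_exp /tn form0 sqrtr0 mul0r (trig_C0 trig) scale1r.
by rewrite scaler0 addr0.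
Qed.

Lemma curved_exp_angle x w b : 0 <= b -> B w w = (rho * b) ^+ 2 ->
  curved_exp x w = C b *: x + (S b / b) *: w.
Proof.
move=> b0 E; rewrite /curved_exp /tn E sqrtr_sqr ger0_norm ?mulr_ge0 ?(ltW rho0) //.
have -> : rho * b / rho = b by field; rewrite gt_eqF.
(* At b = 0 both coefficients are quotients by 0, hence 0 by convention. *)
have [->|bn] := eqVneq b 0; first by rewrite mulr0 !invr0 !mulr0.
by congr (_ + _ *: _); field; rewrite bn gt_eqF.
Qed.

Lemma tangent_log x y : Mo x -> B x (curved_log x y) = 0.
Proof.
move=> Mx; rewrite /curved_log formZ formBZ Mo_kappa //.
by rewrite divfK // subrr mulr0.
Qed.

Lemma tangent_pt x y v : Mo y -> kappa + B x y != 0 -> B y (curved_pt x y v) = 0.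
Proof.
move=> My n0; rewrite /curved_pt formBZ [x + y]addrC -[y in y + x]scale1r B_lin.
by rewrite mul1r Mo_kappa // [B y x]B_sym divfK // subrr.
Qed.

(** [A] inverts [C] at [c], and a nonzero angle has a nonzero sine. The last clause rules out the
    antipode, where the angle is pi. *)
Definition angle_ok c := [/\ 0 <= A c, C (A c) = c & 0 < A c -> 0 < S (A c)].

Section TwoPoints.
Variables x y : 'rV[R]_m.
Hypothesis (Mx : Mo x) (My : Mo y).
Let c := B x y / kappa.
Hypothesis cok : angle_ok c.
Let u := y - c *: x.

Lemma log_dir_tangent : B x u = 0.
Proof. by rewrite /u formBZ Mo_kappa // /c divfK // subrr. Qed.

(** [u] is the part of [y] tangent at [x], so B u u = kappa (1 - c^2), and 1 - c^2 = eps S^2 by the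
    Pythagorean relation at the angle [A c]. *)
Lemma log_dir_sqr : B u u = (rho * S (A c)) ^+ 2.
Proof.
have [_ cA _] := cok.
have := trig_sqr trig (A c); rewrite cA => E.
have -> : B u u = kappa * (1 - c ^+ 2).
  rewrite {2}/u formBZ [B u x]B_sym log_dir_tangent mulr0 subr0 B_sym /u formBZ.
  rewrite Mo_kappa // [B y x]B_sym.
  have -> : B x y = c * kappa by rewrite /c divfK.
  by ring.
have -> : 1 - c ^+ 2 = eps * S (A c) ^+ 2 by lra.
by rewrite /kappa mulrACA epsK mul1r exprMn.
Qed.

Lemma log_dir0 : A c = 0 -> c = 1 /\ u = 0.
Proof.
move=> A0; have [_ cA _] := cok.
split; first by rewrite -cA A0 (trig_C0 trig).
apply: (Mo_def Mx); first exact: log_dir_tangent.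
by rewrite log_dir_sqr A0 (trig_S0 trig) mulr0 expr0n.
Qed.

Lemma curved_logE : curved_log x y = angle_ratio S (A c) *: u.
Proof.
rewrite /curved_log -/c -/u /angle_ratio.
have [A0 cA Spos] := cok.
have [A00|An0] := eqVneq (A c) 0; first by rewrite (log_dir0 A00).2 !scaler0.
have Sp : 0 < S (A c) by apply: Spos; rewrite lt_def An0.
rewrite /tn log_dir_sqr sqrtr_sqr ger0_norm ?mulr_ge0 ?ltW //.
by congr (_ *: _); field; rewrite !gt_eqF.
Qed.

Lemma curved_exp_log s : 0 <= s -> A c != 0 ->
  curved_exp x (s *: curved_log x y) = C (s * A c) *: x + (S (s * A c) / S (A c)) *: u.
Proof.
move=> s0 An0; have [A0 cA Spos] := cok.
have Sp : 0 < S (A c) by apply: Spos; rewrite lt_def An0.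
rewrite curved_logE /angle_ratio (negbTE An0) scalerA.
rewrite (@curved_exp_angle _ _ (s * A c)) ?mulr_ge0 //; last first.
  by rewrite formZZ log_dir_sqr; field; rewrite gt_eqF.
rewrite scalerA; congr (_ + _ *: _).
have [->|sn0] := eqVneq s 0; first by rewrite !mul0r (trig_S0 trig) !mul0r.
by field; rewrite An0 sn0 gt_eqF.
Qed.

End TwoPoints.

(** With th the angle between the points, both sides equal S((1 - s) th)/S(th) x + S(s th)/S(th) y,
    the spherical interpolation formula, which is symmetric under exchanging x with y and s with 1 -
    s. The coefficients are matched by the subtraction formula for [S]. *)
Lemma curved_exp_reverse x y s : Mo x -> Mo y -> angle_ok (B x y / kappa) ->
  0 <= s <= 1 ->
  curved_exp x (s *: curved_log x y) = curved_exp y ((1 - s) *: curved_log y x).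
Proof.
move=> Mx My cok /andP[s0 s1].
have cok' : angle_ok (B y x / kappa) by rewrite B_sym.
have [A0 cA Spos] := cok.
set c := B x y / kappa in cok A0 cA Spos *.
have Eyx : B y x / kappa = c by rewrite B_sym.
(* At angle 0 the points coincide by definiteness on the tangent space, and both logarithms
   vanish. *)
have [A00|An0] := eqVneq (A c) 0.
  have [c1 /[!c1] u0] := log_dir0 Mx My cok A00.
  have xy : y = x.
    by move: u0; rewrite scale1r => /eqP; rewrite subr_eq0 => /eqP.
  have Lx : curved_log x y = 0.
    by rewrite (curved_logE Mx My cok) c1 xy scale1r subrr scaler0.
  have Ly : curved_log y x = 0.
    by rewrite (curved_logE My Mx cok') [B y x]B_sym c1 xy scale1r subrr scaler0.
  by rewrite Lx Ly !scaler0 !curved_exp0.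
rewrite (curved_exp_log Mx My cok s0 An0).
rewrite (curved_exp_log My Mx cok') ?subr_ge0 // Eyx -/c //.
have Sp : 0 < S (A c) by apply: Spos; rewrite lt_def An0.
have Sn : S (A c) != 0 by rewrite gt_eqF.
set th := A c in cA Sp Sn *.
have E1 : S ((1 - s) * th) = S th * C (s * th) - C th * S (s * th).
  by rewrite -(trig_SB trig); congr S; ring.
have E2 : S (s * th) = S th * C ((1 - s) * th) - C th * S ((1 - s) * th).
  by rewrite -(trig_SB trig); congr S; ring.
rewrite !scalerBr !scalerA.
have -> : S (s * th) / S th = C ((1 - s) * th) - S ((1 - s) * th) / S th * c.
  by rewrite -cA E2; field.
have -> : C (s * th) = S ((1 - s) * th) / S th
    + (C ((1 - s) * th) - S ((1 - s) * th) / S th * c) * c.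
  have <- : S (s * th) / S th = C ((1 - s) * th) - S ((1 - s) * th) / S th * c.
    by rewrite -cA E2; field.
  by rewrite E1 -cA; field.
by apply/rowP => j; rewrite !mxE; ring.
Qed.

Lemma form_norm_le v : tn v <= (m%:R + 1) * `|v|.
Proof.
have q0 : 0 <= (m%:R + 1) * `|v| by rewrite mulr_ge0 // addr_ge0.
have m0 : (0 : R) <= m%:R by [].
rewrite -(ger0_norm q0) -sqrtr_sqr /tn ler_wsqrtr //.
apply: le_trans (ler_norm _) _; apply: le_trans (B_le v v) _.
have : 0 <= `|v| ^+ 2 by rewrite sqr_ge0.
have : 0 <= (m%:R * `|v|) ^+ 2 by rewrite sqr_ge0.
have : 0 <= m%:R * `|v| ^+ 2 by rewrite mulr_ge0 // sqr_ge0.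
lra.
Qed.

(** With a = tn v / rho the remainder is (C a - 1) z + ((S a - a) / a) v, and a <= q |v|. The bound
    [Bd] on [z] controls the first term on the unbounded hyperboloid; definiteness on the tangent
    space gives a > 0 for v <> 0. *)
Lemma curved_exp_taylor (Bd D : R) : 0 <= Bd -> 0 <= D ->
  exists2 M : R, 0 <= M & forall z v, Mo z -> `|z| <= Bd -> B z v = 0 -> `|v| <= D ->
    `|curved_exp z v - z - v| <= M * `|v| ^+ 2.
Proof.
move=> Bd0 D0; pose q : R := (m%:R + 1) / rho.
have q0 : 0 <= q by rewrite divr_ge0 ?addr_ge0 ?(ltW rho0).
have [M M0 hM] := trig_taylor trig (mulr_ge0 q0 D0).
exists (M * q ^+ 2 * Bd + M * q).
  by apply: addr_ge0; apply: mulr_ge0 => //; apply: mulr_ge0 => //; exact: sqr_ge0.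
move=> z v Mz zB zv vD.
have [->|vn0] := eqVneq v 0.
  by rewrite curved_exp0 subrr subr0 normr0 expr0n mulr0.
have t0 : 0 < tn v.
  rewrite /tn sqrtr_gt0 lt_def (Mo_pos Mz zv) andbT.
  by apply: contra vn0 => /eqP h; apply/eqP; exact: (Mo_def Mz).
set a := tn v / rho.
have a0 : 0 < a by rewrite divr_gt0.
have aq : a <= q * `|v|.
  by rewrite /a /q mulrAC ler_wpM2r ?invr_ge0 ?(ltW rho0) // form_norm_le.
have aA : 0 <= a <= q * D by rewrite (ltW a0) (le_trans aq) // ler_wpM2l.
have [h1 h2] := hM a aA.
have -> : curved_exp z v - z - v = (C a - 1) *: z + ((S a - a) / a) *: v.
  have -> : (S a - a) / a = rho * S a / tn v - 1.
    by rewrite /a; field; rewrite !gt_eqF.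
  by rewrite /curved_exp -/a; apply/rowP => j; rewrite !mxE; ring.
apply: le_trans (ler_normD _ _) _; rewrite !normrZ mulrDl lerD //.
  have -> : M * q ^+ 2 * Bd * `|v| ^+ 2 = M * (q * `|v|) ^+ 2 * Bd by ring.
  rewrite ler_pM // (le_trans h1) // ler_wpM2l // lerXn2r ?nnegrE ?(ltW a0) //.
  by rewrite mulr_ge0.
have -> : M * q * `|v| ^+ 2 = M * (q * `|v|) * `|v| by ring.
rewrite ler_wpM2r // [`|a^-1|]gtr0_norm ?invr_gt0 // ler_pdivrMr //.
apply: le_trans h2 _; have -> : M * a ^+ 2 = M * a * a by ring.
by apply: ler_wpM2r; [exact: ltW | exact: ler_wpM2l].
Qed.

(** * Uniform bounds where the cosine to the origin stays away from -1 *)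

Section Region.
Variables (D : set R) (L dd : R) (W : normedModType R) (Sw : set W) (z : W -> 'rV[R]_m)
  (o V : 'rV[R]_m).
Hypothesis dd0 : 0 < dd.
Hypothesis D_ok : forall c, D c -> angle_ok c /\ dd <= 1 + c.
Hypothesis D_lip : forall b c, D b -> D c ->
  `|angle_ratio S (A b) - angle_ratio S (A c)| <= L * `|b - c|.
Hypothesis Mo_o : Mo o.
Hypothesis z_blip : blip Sw z.
Hypothesis z_Mo : forall p, Sw p -> Mo (z p).
Hypothesis z_D : forall p, Sw p -> D (B o (z p) / kappa).

Lemma cosine_blip : blip Sw (fun p => B o (z p) / kappa).
Proof.
by apply: blipM; [apply: B_blip => //|]; exact: blip_cst.
Qed.

Lemma curved_log_blip : blip Sw (fun p => curved_log (z p) o).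
Proof.
apply: (@blip_eq _ _ _ _ (fun p => angle_ratio S (A (B o (z p) / kappa))
   *: (o - (B o (z p) / kappa) *: z p))) => [p Sp|].
  rewrite curved_logE //; [by rewrite [B (z p) o]B_sym| exact: z_Mo |].
  by rewrite B_sym; exact: (D_ok (z_D Sp)).1.
apply: blipZ; first exact: (blip_comp D_lip z_D cosine_blip).
apply: blipB; first exact: blip_cst.
by apply: blipZ => //; exact: cosine_blip.
Qed.

Lemma pt_denom_neq0 p : Sw p -> kappa + B o (z p) != 0.
Proof.
move=> /z_D/D_ok[_ h].
have -> : kappa + B o (z p) = kappa * (1 + B o (z p) / kappa) by field.
by rewrite mulf_neq0 // gt_eqF // (lt_le_trans dd0).
Qed.

Lemma curved_pt_blip : blip Sw (fun p => curved_pt o (z p) V).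
Proof.
apply: (@blip_eq _ _ _ _ (fun p => V - (B (z p) V * (kappa^-1
    * (1 + B o (z p) / kappa)^-1)) *: (o + z p))) => [p Sp|].
  rewrite /curved_pt; congr (_ - (_ * _) *: _).
  have h := pt_denom_neq0 Sp.
  have -> : kappa + B o (z p) = kappa * (1 + B o (z p) / kappa) by field.
  exact: esym (invfM kappa _).
apply: blipB; first exact: blip_cst.
apply: blipZ; last by apply: blipD => //; exact: blip_cst.
apply: blipM; first by apply: B_blip => //; exact: blip_cst.
apply: blipM; first exact: blip_cst.
apply: (blipV dd0) => [p Sp|]; first exact: (D_ok (z_D Sp)).2.
by apply: blipD; [exact: blip_cst | exact: cosine_blip].
Qed.

End Region.
End CurvedFactor.

(** * The Euclidean and the Lorentz form *)

Section Forms.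
Variables (R : realType) (m : nat).
Implicit Types u v w : 'rV[R]_m.

Lemma einner_sym u v : einner u v = einner v u.
Proof. by apply: eq_bigr => j _; rewrite mulrC. Qed.

Lemma linner_sym u v : linner u v = linner v u.
Proof. by apply: eq_bigr => j _; rewrite mulrAC. Qed.

Lemma einner_lin u (a : R) v w : einner u (a *: v + w) = a * einner u v + einner u w.
Proof.
rewrite /einner mulr_sumr -big_split /=; apply: eq_bigr => j _.
by rewrite !mxE; ring.
Qed.

Lemma linner_lin u (a : R) v w : linner u (a *: v + w) = a * linner u v + linner u w.
Proof.
rewrite /linner mulr_sumr -big_split /=; apply: eq_bigr => j _.
by rewrite !mxE; ring.
Qed.

Lemma einner_le u v : `|einner u v| <= m%:R * `|u| * `|v|.
Proof.
apply: le_trans (ler_norm_sum _ _ _) _.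
rewrite -mulrA mulr_natl -[X in _ *+ X]card_ord -sumr_const.
by apply: ler_sum => j _; rewrite normrM ler_pM // rV_coord_le.
Qed.

Lemma linner_le u v : `|linner u v| <= m%:R * `|u| * `|v|.
Proof.
apply: le_trans (ler_norm_sum _ _ _) _.
rewrite -mulrA mulr_natl -[X in _ *+ X]card_ord -sumr_const.
apply: ler_sum => j _; rewrite !normrM.
have -> : `|if val j == 0%N then -1 else 1 : R| = 1.
  by case: ifP; rewrite ?normrN normr1.
by rewrite mul1r ler_pM // rV_coord_le.
Qed.

Lemma einner_ge0 v : 0 <= einner v v.
Proof. by apply: sumr_ge0 => j _; rewrite -expr2 sqr_ge0. Qed.

Lemma einner_eq0 v : einner v v = 0 -> v = 0.
Proof.
move=> /eqP; rewrite psumr_eq0 => [/allP h|j _]; last by rewrite -expr2 sqr_ge0.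
apply/rowP => j; rewrite mxE; apply/eqP.
by have := h j (mem_index_enum _); rewrite /= mulf_eq0 orbb.
Qed.

Definition sinner u v : R := \sum_(j < m | val j != 0%N) u 0 j * v 0 j.

(* Qualified because [vector.coord0] shadows the definition. *)
Lemma coord0M u v : Defs.coord0 u * Defs.coord0 v = \sum_(j < m | val j == 0%N) u 0 j * v 0 j.
Proof.
rewrite /Defs.coord0; case: m u v => [|n] u v; first by rewrite !big_ord0 mul0r.
have E : (fun j : 'I_n.+1 => val j == 0%N) =1 pred1 ord0 by move=> j.
by rewrite !(eq_bigl _ _ E) !big_pred1_eq.
Qed.

Lemma linnerE u v : linner u v = sinner u v - Defs.coord0 u * Defs.coord0 v.
Proof.
rewrite coord0M /linner (bigID (fun j : 'I_m => val j == 0%N)) /= addrC.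
rewrite -sumrN; congr (_ + _); apply: eq_bigr => j; last by move=> ->; ring.
by move=> /negbTE ->; ring.
Qed.

Lemma sinner_ge0 v : 0 <= sinner v v.
Proof. by apply: sumr_ge0 => j _; rewrite -expr2 sqr_ge0. Qed.

Lemma einnerE u v : einner u v = sinner u v + Defs.coord0 u * Defs.coord0 v.
Proof. by rewrite coord0M /einner (bigID (fun j : 'I_m => val j == 0%N)) addrC. Qed.

Lemma sinner_comb (a b : R) u v : sinner (a *: u - b *: v) (a *: u - b *: v) =
  a ^+ 2 * sinner u u - 2 * a * b * sinner u v + b ^+ 2 * sinner v v.
Proof.
rewrite /sinner !mulr_sumr -sumrB -big_split /=; apply: eq_bigr => j _.
by rewrite !mxE; ring.
Qed.

(* [y0^2 <v,v> = |y0 v - v0 y|^2 + K v0^2] on the spatial part, when [<y,v> = 0]. *)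
Lemma lorentz_tangent_identity (K : R) y v : linner y y = - K -> linner y v = 0 ->
  Defs.coord0 y ^+ 2 * linner v v =
  sinner (Defs.coord0 y *: v - Defs.coord0 v *: y) (Defs.coord0 y *: v - Defs.coord0 v *: y)
  + K * Defs.coord0 v ^+ 2.
Proof.
move=> yy yv; rewrite sinner_comb.
have -> : sinner v y = Defs.coord0 y * Defs.coord0 v.
  have := linnerE v y; rewrite linner_sym yv => h; lra.
have -> : sinner y y = Defs.coord0 y ^+ 2 - K by have := linnerE y y; rewrite yy; lra.
have -> : linner v v = sinner v v - Defs.coord0 v ^+ 2 by rewrite linnerE; ring.
ring.
Qed.

Lemma lorentz_tangent_ge0 (K : R) y v : 0 < K -> on_model (Hyp K) y ->
  linner y v = 0 -> 0 <= linner v v.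
Proof.
move=> K0 [yy y0] yv; have E := lorentz_tangent_identity yy yv.
rewrite -(@pmulr_rge0 _ (Defs.coord0 y ^+ 2)) ?exprn_gt0 // E.
by rewrite addr_ge0 ?sinner_ge0 // mulr_ge0 ?sqr_ge0 ?(ltW K0).
Qed.

Lemma lorentz_tangent_def (K : R) y v : 0 < K -> on_model (Hyp K) y ->
  linner y v = 0 -> linner v v = 0 -> v = 0.
Proof.
move=> K0 [yy y0] yv vv; have := lorentz_tangent_identity yy yv.
rewrite vv mulr0 => E.
(* The identity writes 0 as a sum of two nonnegative terms, so the time coordinate of [v] vanishes;
   on such vectors the Lorentz and Euclidean squares agree. *)
have v0 : Defs.coord0 v = 0.
  have h1 := sinner_ge0 (Defs.coord0 y *: v - Defs.coord0 v *: y).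
  have h2 : 0 <= K * Defs.coord0 v ^+ 2 by rewrite mulr_ge0 ?sqr_ge0 ?(ltW K0).
  have /eqP : K * Defs.coord0 v ^+ 2 = 0 by lra.
  by rewrite mulf_eq0 gt_eqF //= sqrf_eq0 => /eqP.
apply: einner_eq0; have := linnerE v v; have := einnerE v v.
by rewrite v0 vv; lra.
Qed.

Lemma coord0_basis (c : R) : (0 < m)%N ->
  Defs.coord0 (\row_(j < m) (if val j == 0%N then c else 0)) = c.
Proof.
rewrite /Defs.coord0; case: m => // n _.
rewrite (eq_bigl (pred1 ord0)) ?big_pred1_eq ?mxE //.
Qed.

Lemma sinner_basis (c : R) u :
  sinner (\row_(j < m) (if val j == 0%N then c else 0)) u = 0.
Proof.
by apply: big1 => j /negbTE jn; rewrite mxE jn mul0r.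
Qed.

End Forms.

Lemma origin_on_model (R : realType) (M : model R) (n : nat) :
  param_pos M -> on_model M (origin_pt (amb M n) M).
Proof.
case: M => [K|r|] //= p0.
  have K0 := ltW p0.
  by rewrite linnerE coord0_basis // sinner_basis sub0r -expr2 sqr_sqrtr // sqrtr_gt0.
by rewrite einnerE coord0_basis // sinner_basis add0r -expr2.
Qed.

(** * Inverse cosines near 1, for the comparison of distances *)

Section Distances.
Variable R : realType.

(** On the sphere sqrt(1 - c) is a multiple of the chord, so this bounds geodesic by ambient
    distance. For c >= 1/2 the angle is at most 2 sin <= 4 sqrt(1 - c); otherwise sqrt(1 - c) >= 1/2
    and the angle is at most pi. *)
Lemma acos_le_sqrt (c : R) : -1 <= c <= 1 ->
  acos c <= (4 + 2 * pi) * Num.sqrt (1 - c).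
Proof.
move=> c1; have /andP[cl cr] := c1.
have th0 := acos_ge0 c1; have thpi := acos_lepi c1.
have cth : cos (acos c) = c by rewrite acosK // in_itv.
set th := acos c in th0 thpi cth *; set s := Num.sqrt _.
have s0 : 0 <= s by exact: sqrtr_ge0.
have s2 : s ^+ 2 = 1 - c by rewrite sqr_sqrtr // subr_ge0.
have ps : 0 <= pi * s by rewrite mulr_ge0 // pi_ge0.
have [ge|lt] := leP 2^-1 c.
  have := mulr_cos_le_sin th0 thpi; rewrite cth => h1.
  have h2 : th * 2^-1 <= th * c by rewrite ler_wpM2l.
  have h3 : sin th <= 2 * s.
    have h4 : sin th ^+ 2 <= (2 * s) ^+ 2.
      rewrite sin2cos2 cth exprMn s2.
      have : 0 <= (1 - c) * (1 - c) by rewrite mulr_ge0 // subr_ge0.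
      lra.
    apply: le_trans (ler_norm _) _.
    by rewrite -(@ler_pXn2r _ 2) ?nnegrE ?mulr_ge0 // real_normK ?num_real.
  lra.
have : 2^-1 <= s.
  rewrite -(@ler_pXn2r _ 2) ?nnegrE // s2.
  have -> : (2^-1 : R) ^+ 2 = 4^-1 by field.
  lra.
move=> h; have : pi * 2^-1 <= pi * s by rewrite ler_wpM2l // pi_ge0.
lra.
Qed.

(** For c >= 1 this is ln(1 + t) <= t with t = c - 1 + w and w^2 = (c - 1)(c + 1). The bound also
    covers c < 1, where c + w <= 1 and the logarithm is nonpositive, so it applies directly to the
    quotient in [gdist] for any two points. *)
Lemma acosh_le_near1 (c del : R) : 0 <= del -> c - 1 <= del ^+ 2 ->
  acoshR c <= del * (del + `|c| + 1).
Proof.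
move=> d0 h; rewrite /acoshR; set w := Num.sqrt _.
have w0 : 0 <= w by exact: sqrtr_ge0.
have rhs0 : 0 <= del * (del + `|c| + 1) by rewrite mulr_ge0 // !addr_ge0.
have [lt|ge] := ltP c 1.
  apply: le_trans rhs0; apply: ln_le0.
  have [c2|c2] := leP (c ^+ 2) 1.
    have -> : w = 0 by rewrite /w ler0_sqrtr // subr_le0.
    by rewrite addr0 ltW.
  have : w <= `|c| by rewrite -sqrtr_sqr ler_wsqrtr // gerBl.
  have [c0|c0] := leP 0 c; last by rewrite ltr0_norm //; lra.
  by move: c2; rewrite ltNge exprn_ile1 // ltW.
have wd : w <= del * (`|c| + 1).
  rewrite -(@ler_pXn2r _ 2) ?nnegrE ?mulr_ge0 ?addr_ge0 //.
  rewrite sqr_sqrtr; last by rewrite subr_ge0 exprn_ege1.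
  rewrite ger0_norm ?(le_trans ler01) //.
  have -> : c ^+ 2 - 1 = (c - 1) * (c + 1) by ring.
  rewrite exprMn ler_pM ?subr_ge0 ?addr_ge0 ?(le_trans ler01) //.
  by rewrite expr2 ler_peMl // ?addr_ge0 ?(le_trans ler01) // lerDr (le_trans ler01).
have -> : c + w = 1 + (c - 1 + w) by ring.
apply: le_trans (le_ln1Dx _) _; first by lra.
lra.
Qed.

End Distances.

(** * The common interface of the three models *)

(** These are all the facts about a factor that the convergence argument uses; after they are
    proved, the geometry of the model no longer enters. [Z] stands for the projection of the compact
    region. *)
Record regular_factor (R : realType) (m : nat) (M : model R) (V : 'rV[R]_m)
    (Z : set 'rV[R]_m) : Prop := RegularFactor {
  rf_exp : forall D, 0 <= D -> exists2 Me, 0 <= Me & forall z v,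
    Z z -> is_tangent M z v -> `|v| <= D -> `|expm M z v - z - v| <= Me * `|v| ^+ 2;
  rf_reverse : forall z s, Z z -> 0 <= s <= 1 ->
    expm M (origin_pt m M) (s *: logm M (origin_pt m M) z)
    = expm M z ((1 - s) *: logm M z (origin_pt m M));
  rf_tangent_log : forall z a, Z z ->
    is_tangent M z (a *: logm M z (origin_pt m M));
  rf_tangent_pt : forall z a, Z z ->
    is_tangent M z (a *: ptm M (origin_pt m M) z V);
  rf_log : blip Z (fun z => logm M z (origin_pt m M));
  rf_pt : blip Z (fun z => ptm M (origin_pt m M) z V);
  rf_dist : exists2 Cd, 0 <= Cd & forall z z', Z z -> Z z' ->
    gdist M z z' <= Cd * `|z - z'| }.

Section RegularFactor.
Variables (R : realType) (m : nat) (V : 'rV[R]_m) (Z : set 'rV[R]_m) (Bd : R).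
Implicit Types x y z v : 'rV[R]_m.
Hypothesis Bd0 : 0 <= Bd.
Hypothesis Z_le : forall z, Z z -> `|z| <= Bd.

Lemma blip_id : blip Z (fun z => z).
Proof.
exists (Bd + 1) => [|]; first by rewrite addr_ge0.
split=> [z /Z_le h|z z' _ _]; first by rewrite (le_trans h) // lerDl.
by rewrite ler_peMl // lerDr.
Qed.

Lemma regular_Euc : regular_factor Euc V Z.
Proof.
split=> //=.
- move=> D D0; exists 0 => // z v _ _ _.
  by rewrite -addrA -opprD subrr normr0 mul0r.
- move=> z s _ _; rewrite subr0 !sub0r scalerN scalerBl scale1r add0r.
  by rewrite opprB addrCA subrr addr0.
- apply: blipB; [exact: blip_cst | exact: blip_id].
- exact: blip_cst.
- exists (m%:R + 1) => [|z z' _ _]; first by rewrite addr_ge0.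
  rewrite -[`|z - z'|]distrC; exact: (form_norm_le (@einner_le R m)).
Qed.

Section Sphere.
Variables (r d : R).
Hypothesis (r0 : 0 < r) (d0 : 0 < d).
Let o := origin_pt m (Sph r).
Hypothesis o_on : on_model (Sph r) o.
Hypothesis Z_on : forall z, Z z -> on_model (Sph r) z.
Hypothesis Z_cut : forall z, Z z -> d <= r ^+ 2 + einner o z.

Lemma expm_Sph x v : expm (Sph r) x v = curved_exp (@einner R m) r cos sin x v.
Proof.
rewrite /expm /curved_exp; case: eqP => // ->.
have -> : einner (0 : 'rV[R]_m) 0 = 0 by apply: big1 => j _; rewrite !mxE mul0r.
by rewrite sqrtr0 mul0r cos0 scale1r scaler0 addr0.
Qed.

Lemma logm_Sph x y : logm (Sph r) x y = curved_log (@einner R m) 1 r (@acos R) x y.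
Proof.
rewrite /logm /curved_log mul1r; case: eqP => // ->.
by rewrite scaler0.
Qed.

Lemma ptm_Sph x y v : ptm (Sph r) x y v = curved_pt (@einner R m) 1 r x y v.
Proof. by rewrite /curved_pt mul1r. Qed.

Lemma einner_sub_sphere x y : on_model (Sph r) x -> on_model (Sph r) y ->
  einner (x - y) (x - y) = 2 * r ^+ 2 * (1 - einner x y / r ^+ 2).
Proof.
move=> /= hx hy.
have E (w : 'rV[R]_m) : einner w (x - y) = einner w x - einner w y.
  by have := einner_lin w (-1) y x; rewrite scaleN1r addrC => ->; ring.
rewrite E einner_sym E [einner (x - y) y]einner_sym E hx hy [einner y x]einner_sym.
by field; rewrite gt_eqF.
Qed.

Lemma sphere_cosine_le1 x y : on_model (Sph r) x -> on_model (Sph r) y ->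
  einner x y / r ^+ 2 <= 1.
Proof.
move=> hx hy; have := einner_ge0 (x - y); rewrite einner_sub_sphere //.
by rewrite pmulr_rge0 ?mulr_gt0 ?exprn_gt0 // subr_ge0.
Qed.

Lemma sphere_cosine_geN1 x y : on_model (Sph r) x -> on_model (Sph r) y ->
  -1 <= einner x y / r ^+ 2.
Proof.
move=> hx hy.
have hy' : on_model (Sph r) (- y).
  by move: hy => /= <-; apply: eq_bigr => j _; rewrite !mxE mulrNN.
have := sphere_cosine_le1 hx hy'.
have -> : einner x (- y) = - einner x y.
  by rewrite /einner -sumrN; apply: eq_bigr => j _; rewrite !mxE mulrN.
by rewrite mulNr; lra.
Qed.

Lemma regular_Sph : regular_factor (Sph r) V Z.
Proof.
have tr := cos_sin_trig_pair R.
pose Mo : set 'rV[R]_m := [set x | einner x x = 1 * r ^+ 2].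
have onMo x : on_model (Sph r) x -> Mo x by move=> /= h; rewrite /Mo /= mul1r.
have Mok x : Mo x -> einner x x = 1 * r ^+ 2 by [].
have Mop x v : Mo x -> einner x v = 0 -> 0 <= einner v v.
  by move=> _ _; exact: einner_ge0.
have Mod x v : Mo x -> einner x v = 0 -> einner v v = 0 -> v = 0.
  by move=> _ _; exact: einner_eq0.
have d'0 : 0 < d / r ^+ 2 by rewrite divr_gt0 // exprn_gt0.
(* Dividing [Z_cut] by r^2 bounds 1 + c below by d / r^2, where c is the cosine of the distance to
   the origin. *)
pose D : set R := [set c | d / r ^+ 2 - 1 <= c <= 1].
have [L L0 hL] := acos_ratio_lipschitz d'0.
have Dok c : D c -> angle_ok cos sin (@acos R) c /\ d / r ^+ 2 <= 1 + c.
  move=> /andP[c1 c2]; split; last by lra.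
  have hc : -1 <= c <= 1 by rewrite c2 andbT; lra.
  split; [exact: acos_ge0 | by rewrite acosK // in_itv |].
  move=> a0; rewrite sin_gt0_pi // a0 acos_ltpi // c2 andbT; lra.
have ZD z : Z z -> D (einner o z / (1 * r ^+ 2)).
  move=> Zz; rewrite mul1r /D /=; apply/andP; split.
    have -> : d / r ^+ 2 - 1 = (d - r ^+ 2) / r ^+ 2 by field; rewrite gt_eqF.
    by rewrite ler_wpM2r ?invr_ge0 ?sqr_ge0 //; have := Z_cut Zz; lra.
  by apply: sphere_cosine_le1 => //; exact: Z_on.
have ZMo z : Z z -> Mo z by move=> /Z_on/onMo.
have oMo : Mo o := onMo _ o_on.
split.
- move=> D' D'0.
  have [Me Me0 hMe] := curved_exp_taylor (@einner_le R m)
    tr r0 Mop Mod Bd0 D'0.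
  exists Me => // z v Zz tz vD; rewrite expm_Sph; apply: hMe => //.
    exact: ZMo.
  exact: Z_le.
- move=> z s Zz s01; rewrite !expm_Sph !logm_Sph -/o.
  apply: (curved_exp_reverse (@einner_sym R m) (@einner_lin R m) (@einner_le R m)
    tr r0 Mok Mod) => //; first exact: ZMo.
  exact: (Dok _ (ZD _ Zz)).1.
- move=> z a Zz; rewrite logm_Sph /= (formZ (@einner_lin R m) (@einner_le R m)).
  rewrite (tangent_log (@einner_lin R m) (@einner_le R m) _ tr r0 Mok) ?mulr0 //.
  exact: ZMo.
- move=> z a Zz; rewrite ptm_Sph /= (formZ (@einner_lin R m) (@einner_le R m)).
  rewrite (tangent_pt (@einner_sym R m) (@einner_lin R m) Mok) ?mulr0 //.
    exact: ZMo.
  exact: (pt_denom_neq0 tr r0 d'0 Dok ZD Zz).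
- apply: (blip_eq _ (curved_log_blip (@einner_sym R m) (@einner_lin R m)
    (fun W S => @blip_einner R W S m) tr r0 Mok Mod Dok hL oMo blip_id ZMo ZD)).
  by move=> z _; rewrite logm_Sph.
- apply: (blip_eq _ (@curved_pt_blip _ _ _ (fun W S => @blip_einner R W S m)
    _ _ _ _ _ tr r0 D _ _ _ _ o V d'0 Dok blip_id ZD)).
  by move=> z _; rewrite ptm_Sph.
(* The factor 4 + 2 pi comes from [acos_le_sqrt], and (m + 1) / r from sqrt(1 - c) <= |x - y| / r in
   the Euclidean norm, itself at most m + 1 times the sup norm. *)
- exists (r * ((4 + 2 * pi) * ((m%:R + 1) / r))).
    by rewrite !mulr_ge0 ?addr_ge0 ?mulr_ge0 ?invr_ge0 ?pi_ge0 ?(ltW r0).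
  move=> x y /Z_on hx /Z_on hy /=.
  have hc : -1 <= einner x y / r ^+ 2 <= 1.
    by rewrite sphere_cosine_geN1 // sphere_cosine_le1.
  rewrite -!mulrA ler_pM2l //; apply: le_trans (acos_le_sqrt hc) _.
  rewrite ler_wpM2l ?addr_ge0 ?mulr_ge0 ?pi_ge0 //.
  have E : (1 - einner x y / r ^+ 2) <= (r^-1 * Num.sqrt (einner (x - y) (x - y))) ^+ 2.
    rewrite exprMn sqr_sqrtr ?einner_ge0 // einner_sub_sphere //.
    have -> : r^-1 ^+ 2 * (2 * r ^+ 2 * (1 - einner x y / r ^+ 2))
      = 2 * (1 - einner x y / r ^+ 2) by field; rewrite gt_eqF.
    by case/andP: hc => _ h; lra.
  apply: (@le_trans _ _ (r^-1 * Num.sqrt (einner (x - y) (x - y)))).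
    rewrite -[leRHS]ger0_norm ?mulr_ge0 ?invr_ge0 ?(ltW r0) ?sqrtr_ge0 //.
    by rewrite -sqrtr_sqr ler_wsqrtr.
  have := form_norm_le (@einner_le R m) (x - y).
  have -> : (m%:R + 1) * (r^-1 * `|x - y|) = r^-1 * ((m%:R + 1) * `|x - y|) by ring.
  by move=> h; rewrite ler_wpM2l ?invr_ge0 ?(ltW r0).
Qed.

End Sphere.

Section Hyperbolic.
Variables (K : R).
Hypothesis (K0 : 0 < K).
Let o := origin_pt m (Hyp K).
Hypothesis o_on : on_model (Hyp K) o.
Hypothesis Z_on : forall z, Z z -> on_model (Hyp K) z.

Let rho := Num.sqrt K.
Let rho2 : rho ^+ 2 = K. Proof. by rewrite sqr_sqrtr // ltW. Qed.
Let rho0 : 0 < rho. Proof. by rewrite sqrtr_gt0. Qed.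

Lemma expm_Hyp x v : expm (Hyp K) x v = curved_exp (@linner R m) rho (@coshR R) (@sinhR R) x v.
Proof.
rewrite /expm /curved_exp; case: eqP => // ->.
have -> : linner (0 : 'rV[R]_m) 0 = 0 by apply: big1 => j _; rewrite !mxE mulr0.
by rewrite sqrtr0 mul0r (trig_C0 (cosh_sinh_trig_pair R)) scale1r scaler0 addr0.
Qed.

Lemma logm_Hyp x y : logm (Hyp K) x y = curved_log (@linner R m) (-1) rho (@acoshR R) x y.
Proof.
rewrite /logm /curved_log rho2 mulN1r invrN mulrN scaleNr opprK /gdist mulNr.
by case: eqP => // ->; rewrite scaler0.
Qed.

Lemma ptm_Hyp x y v : ptm (Hyp K) x y v = curved_pt (@linner R m) (-1) rho x y v.
Proof.
rewrite /curved_pt /= rho2 mulN1r.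
have -> : - K + linner x y = - (K - linner x y) by rewrite opprB addrC.
by rewrite invrN mulrN scaleNr opprK.
Qed.

(** The quotient equals z_0 / sqrt K, and z_0^2 is K plus the squared spatial part. *)
Lemma lorentz_cosine_ge1 z : on_model (Hyp K) z -> 1 <= linner o z / (-1 * rho ^+ 2).
Proof.
move=> [zz z0]; rewrite mulN1r invrN mulrN rho2.
(* Dimension m = 0 is excluded by z_0 > 0, an empty sum being 0. *)
have o0 : Defs.coord0 o = rho.
  rewrite /o /= coord0_basis //; case: m z z0 {zz} => // z.
  by rewrite /Defs.coord0 big_ord0 ltxx.
have -> : linner o z = - (rho * Defs.coord0 z).
  by rewrite linnerE sinner_basis sub0r o0.
have zr : rho <= Defs.coord0 z.
  rewrite -(@ler_pXn2r _ 2) ?nnegrE ?(ltW rho0) ?(ltW z0) // rho2.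
  by have := linnerE z z; have := sinner_ge0 z; rewrite zz; lra.
rewrite -rho2.
have -> : - (- (rho * Defs.coord0 z) / rho ^+ 2) = Defs.coord0 z / rho.
  by field; rewrite gt_eqF.
by rewrite ler_pdivlMr // mul1r.
Qed.

Lemma linner_sub_hyp x y : on_model (Hyp K) x -> on_model (Hyp K) y ->
  linner (x - y) (x - y) = 2 * K * (- linner x y / K - 1).
Proof.
move=> [hx _] [hy _].
have E (w : 'rV[R]_m) : linner w (x - y) = linner w x - linner w y.
  by have := linner_lin w (-1) y x; rewrite scaleN1r addrC => ->; ring.
rewrite E linner_sym E [linner (x - y) y]linner_sym E hx hy [linner y x]linner_sym.
by field; rewrite gt_eqF.
Qed.

Lemma regular_Hyp : regular_factor (Hyp K) V Z.
Proof.
have tr := cosh_sinh_trig_pair R.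
pose Mo : set 'rV[R]_m := on_model (Hyp K).
have Mok x : Mo x -> linner x x = -1 * rho ^+ 2 by move=> [h _]; rewrite rho2 mulN1r.
have Mop x v : Mo x -> linner x v = 0 -> 0 <= linner v v.
  exact: lorentz_tangent_ge0.
have Mod x v : Mo x -> linner x v = 0 -> linner v v = 0 -> v = 0.
  exact: lorentz_tangent_def.
pose D : set R := [set c | 1 <= c].
have [L L0 hL] := acosh_ratio_lipschitz R.
have Dok c : D c -> angle_ok (@coshR R) (@sinhR R) (@acoshR R) c /\ 2 <= 1 + c.
  move=> c1; have [a0 ca] := acosh_props c1.
  split; last by move: c1; rewrite /D /=; lra.
  by split=> // ap; rewrite (lt_le_trans ap) // sinh_ge_id.
have ZD z : Z z -> D (linner o z / (-1 * rho ^+ 2)).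
  by move=> /Z_on; exact: lorentz_cosine_ge1.
have ZMo z : Z z -> Mo z by move=> /Z_on.
have two0 : 0 < 2 :> R by [].
split.
- move=> D' D'0.
  have [Me Me0 hMe] := curved_exp_taylor (@linner_le R m)
    tr rho0 Mop Mod Bd0 D'0.
  exists Me => // z v Zz tz vD; rewrite expm_Hyp; apply: hMe => //.
    exact: ZMo.
  exact: Z_le.
- move=> z s Zz s01; rewrite !expm_Hyp !logm_Hyp -/o.
  apply: (curved_exp_reverse (@linner_sym R m) (@linner_lin R m) (@linner_le R m)
    tr rho0 Mok Mod) => //; first exact: ZMo.
  exact: (Dok _ (ZD _ Zz)).1.
- move=> z a Zz; rewrite logm_Hyp /= (formZ (@linner_lin R m) (@linner_le R m)).
  rewrite (tangent_log (@linner_lin R m) (@linner_le R m) _ tr rho0 Mok) ?mulr0 //.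
  exact: ZMo.
- move=> z a Zz; rewrite ptm_Hyp /= (formZ (@linner_lin R m) (@linner_le R m)).
  rewrite (tangent_pt (@linner_sym R m) (@linner_lin R m) Mok) ?mulr0 //.
    exact: ZMo.
  exact: (pt_denom_neq0 tr rho0 two0 Dok ZD Zz).
- apply: (blip_eq _ (curved_log_blip (@linner_sym R m) (@linner_lin R m)
    (fun W S => @blip_linner R W S m) tr rho0 Mok Mod Dok hL o_on blip_id ZMo ZD)).
  by move=> z _; rewrite logm_Hyp.
- apply: (blip_eq _ (@curved_pt_blip _ _ _ (fun W S => @blip_linner R W S m)
    _ _ _ _ _ tr rho0 D _ _ _ _ o V two0 Dok blip_id ZD)).
  by move=> z _; rewrite ptm_Hyp.
(* [acosh_le_near1] is used with del = q |x - y|. One factor del is kept, giving linearity in |x -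
   y|; in the other factor, del is at most 2 q Bd and |c| at most [cm], by boundedness of the
   region. *)
- pose q : R := (m%:R + 1) / rho.
  have q0 : 0 <= q by rewrite divr_ge0 ?addr_ge0 ?(ltW rho0).
  pose cm : R := m%:R * Bd * Bd / K.
  have cm0 : 0 <= cm by rewrite !mulr_ge0 ?invr_ge0 ?(ltW K0).
  exists (rho * (q * (q * (2 * Bd) + cm + 1))).
    apply: mulr_ge0; first exact: ltW.
    apply: mulr_ge0 => //; apply: addr_ge0 => //; apply: addr_ge0 => //.
    by apply: mulr_ge0 => //; exact: mulr_ge0.
  move=> x y Zx Zy; have hx := Z_on Zx; have hy := Z_on Zy.
  have bx := Z_le Zx; have by_ := Z_le Zy.
  set c := - linner x y / K.
  have qd0 : 0 <= q * `|x - y| by rewrite mulr_ge0.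
  have E : c - 1 <= (q * `|x - y|) ^+ 2.
    have -> : c - 1 = linner (x - y) (x - y) / (2 * K).
      by rewrite linner_sub_hyp // -/c; field; rewrite gt_eqF.
    rewrite ler_pdivrMr ?mulr_gt0 //.
    apply: le_trans (ler_norm _) _; apply: le_trans (linner_le _ _) _.
    have -> : (q * `|x - y|) ^+ 2 * (2 * K) = 2 * (m%:R + 1) ^+ 2 * `|x - y| ^+ 2.
      by rewrite -rho2 /q; field; rewrite gt_eqF.
    rewrite -mulrA -expr2 ler_wpM2r ?sqr_ge0 //.
    have : (0 : R) <= m%:R by [].
    have : 0 <= (m%:R : R) ^+ 2 by rewrite sqr_ge0.
    lra.
  rewrite /gdist -/rho -/c -mulrA ler_pM2l //.
  apply: le_trans (acosh_le_near1 qd0 E) _.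
  rewrite [leRHS]mulrAC; apply: ler_wpM2l => //; rewrite lerD2r; apply: lerD.
    apply: ler_wpM2l => //; apply: le_trans (ler_normB _ _) _; lra.
  rewrite /c /cm mulNr normrN normrM [`|K^-1|]gtr0_norm ?invr_gt0 //.
  rewrite ler_wpM2r ?invr_ge0 ?(ltW K0) //.
  apply: le_trans (linner_le _ _) _.
  by rewrite -!mulrA ler_wpM2l // ler_pM.
Qed.

End Hyperbolic.
End RegularFactor.

(** * Regularity of a factor from compactness of the region *)

Lemma blip_precomp (R : realType) (W U X : normedModType R) (S : set W) (Z : set U)
    (g : U -> X) (z : W -> U) :
  blip Z g -> (forall p, S p -> Z (z p)) -> blip S z -> blip S (fun p => g (z p)).
Proof.
move=> [M M0 [bg lg]] zZ [N N0 [bz lz]]; exists (M + M * N).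
  by rewrite addr_ge0 // mulr_ge0.
have MN : 0 <= M * N by rewrite mulr_ge0.
split=> [p Sp|p q Sp Sq].
  by rewrite (le_trans (bg _ (zZ _ Sp))) // lerDl.
apply: le_trans (lg _ _ (zZ _ Sp) (zZ _ Sq)) _.
rewrite mulrDl ler_wpDl ?mulr_ge0 // -mulrA ler_wpM2l //; exact: lz.
Qed.

Lemma compact_pos_lower_bound (R : realType) (W : normedModType R) (S : set W)
    (phi : W -> R) (L : R) : 0 < L -> compact S ->
  (forall p q, `|phi p - phi q| <= L * `|p - q|) ->
  (forall p, S p -> 0 < phi p) -> exists2 d, 0 < d & forall p, S p -> d <= phi p.
Proof.
move=> L0 cS lphi pos.
have near_d : \forall d \near 0^'+, S `<=` (fun d p => d <= phi p) (d : R).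
  move/compact_near_coveringP : cS; apply => p0 Sp0.
  have f0 := pos _ Sp0.
  near=> p d.
  have h1 : d <= phi p0 / 2.
    by near: d; apply: nbhs_right_le; rewrite divr_gt0.
  have h2 : `|p - p0| <= phi p0 / 2 / L.
    near: p; apply/nbhs_normP; exists (phi p0 / 2 / L).
      by rewrite /= !divr_gt0.
    by move=> z /= /ltW; rewrite distrC.
  have h3 := lphi p p0; rewrite ler_pdivlMr // in h2.
  by have := ler_norm (phi p0 - phi p); rewrite distrC /=; lra.
near (0 : R)^'+ => d; exists d; first by near: d; exact: nbhs_right_gt.
by near: d.
Unshelve. all: by end_near. Qed.

(** The quantity is half of |o + z|^2, which vanishes only at the antipode. *)
Lemma not_cut_pos (R : realType) (m : nat) (r : R) (o z : 'rV[R]_m) :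
  on_model (Sph r) o -> on_model (Sph r) z -> not_cut (Sph r) o z ->
  0 < r ^+ 2 + einner o z.
Proof.
move=> /= oo zz zo.
have E : einner (o + z) (o + z) = 2 * (r ^+ 2 + einner o z).
  have L w : einner w (o + z) = einner w o + einner w z.
    by have := einner_lin w 1 o z; rewrite scale1r mul1r.
  rewrite L [einner (o + z) o]einner_sym L [einner (o + z) z]einner_sym L oo zz.
  by rewrite [einner z o]einner_sym; ring.
rewrite lt_def; apply/andP; split; last first.
  by have := einner_ge0 (o + z); rewrite E; lra.
apply/negP => /eqP h; apply: zo.
have /einner_eq0/eqP : einner (o + z) (o + z) = 0 by rewrite E h mulr0.
by rewrite addrC addr_eq0 => /eqP.
Qed.

(** Compactness supplies what the models ask for: a bound on the points and, on the sphere, a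
    uniform gap from the antipode in place of the pointwise condition [not_cut]. *)
Lemma regular_factor_compact (R : realType) (W : normedModType R) (K : set W) (m : nat)
    (z : W -> 'rV[R]_m) (M : model R) (V : 'rV[R]_m) :
  compact K -> (forall p q, `|z p - z q| <= `|p - q|) -> (forall p, `|z p| <= `|p|) ->
  param_pos M -> on_model M (origin_pt m M) ->
  (forall p, K p -> on_model M (z p)) ->
  (forall p, K p -> not_cut M (origin_pt m M) (z p)) ->
  regular_factor M V (z @` K).
Proof.
move=> cK lz bz pM oM Mz cz.
have [B [_ hB]] := compact_bounded cK.
pose Bd := `|B| + 1.
have Bd0 : 0 <= Bd by rewrite addr_ge0.
have ZB y : (z @` K) y -> `|y| <= Bd.
  move=> [p Kp <-]; apply: le_trans (bz p) _; apply: hB => //.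
  by rewrite (le_lt_trans (ler_norm _)) // ltrDl.
have ZM y : (z @` K) y -> on_model M y by move=> [p Kp <-]; exact: Mz.
case: M pM oM Mz cz ZM => [k|r|] pM oM Mz cz ZM.
- exact: (regular_Hyp _ Bd0).
- set o := origin_pt m (Sph r) in oM cz.
  pose L := m%:R * `|o| + 1.
  have L0 : 0 < L by rewrite ltr_wpDl // mulr_ge0.
  have [] := @compact_pos_lower_bound R W K (fun p => r ^+ 2 + einner o (z p)) L L0 cK.
  + move=> p q; rewrite opprD addrACA subrr add0r.
    have -> : einner o (z p) - einner o (z q) = einner o (z p - z q).
      by rewrite addrC -[in RHS]scaleN1r [in RHS]addrC einner_lin mulN1r.
    apply: le_trans (einner_le _ _) _; apply: ler_pM => //.
    by rewrite lerDl.
  + by move=> p Kp; apply: not_cut_pos => //; [exact: Mz | exact: cz].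
  move=> d d0 hd; apply: (regular_Sph _ Bd0 ZB pM d0 oM ZM).
  by move=> y [p Kp <-]; exact: hd.
- exact: (regular_Euc _ Bd0).
Qed.

(** * Local error of one step on a factor *)

Lemma expRN_taylor (R : realType) (x : R) : 0 <= x ->
  0 <= 1 - expR (- x) <= x /\ `|1 - expR (- x) - x| <= x ^+ 2.
Proof.
move=> x0; have h1 := expR_ge1Dx (- x).
(* exp(-x) <= 1/(1 + x), and (1 - x + x^2)(1 + x) = 1 + x^3 >= 1. *)
have h2 : expR (- x) <= 1 - x + x ^+ 2.
  have px : 0 < 1 + x by rewrite ltr_wpDr.
  rewrite expRN; apply: (@le_trans _ _ (1 + x)^-1).
    by rewrite lef_pV2 ?posrE ?expR_gt0 // expR_ge1Dx.
  rewrite -[leLHS]mul1r ler_pdivrMr //.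
  have : 0 <= x ^+ 3 by rewrite exprn_ge0.
  lra.
have h3 : expR (- x) <= 1 by rewrite -expR0 ler_expR oppr_le0.
split; first by apply/andP; split; lra.
by rewrite ler_norml; apply/andP; split; lra.
Qed.

Lemma factor_step_error (R : realType) (m : nat) (M : model R) (V : 'rV[R]_m)
    (Z : set 'rV[R]_m) (tau T : R) : regular_factor M V Z -> 0 < tau -> 0 <= T ->
  exists2 C : R, 0 <= C & forall (y : 'rV[R]_m) (phi h : R),
    Z y -> 0 <= phi <= 1 -> 0 <= h <= T ->
    Z (expm M y ((h * phi) *: ptm M (origin_pt m M) y V)) ->
    `|expm M (origin_pt m M) (expR (- (h * (tau^-1 + phi))) *:
         logm M (origin_pt m M) (expm M y ((h * phi) *: ptm M (origin_pt m M) y V)))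
      - y - h *: ((tau^-1 + phi) *: logm M y (origin_pt m M)
                  + phi *: ptm M (origin_pt m M) y V)| <= C * h ^+ 2.
Proof.
move=> rf tau0 T0; set o := origin_pt m M.
have [La La0 [bl ll]] := rf_log rf; have [P P0 [bp _]] := rf_pt rf.
pose c1 := tau^-1 + 1.
have ti0 : 0 <= tau^-1 by rewrite invr_ge0 ltW.
have c10 : 0 <= c1 by rewrite addr_ge0.
have [M1 M10 hM1] := rf_exp rf (mulr_ge0 T0 P0).
have [M2 M20 hM2] := rf_exp rf (mulr_ge0 T0 (mulr_ge0 c10 La0)).
(* Bounds |ys - y| / h: the transport term contributes P, and the quadratic remainder of the
   exponential is made linear by h^2 <= T h. *)
pose b1 := M1 * T * P ^+ 2 + P.
exists (M1 * P ^+ 2 + M2 * (c1 * La) ^+ 2 + c1 ^+ 2 * La + c1 * (La * b1)).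
  by rewrite !addr_ge0 ?mulr_ge0 ?exprn_ge0 ?mulr_ge0 // addr_ge0 ?mulr_ge0 ?exprn_ge0.
move=> y phi h Zy /andP[phi0 phi1] /andP[h0 hT]; set v1 := (h * phi) *: _.
set ys := expm M y v1 => Zys.
pose c := tau^-1 + phi; rewrite -/c.
have c0 : 0 <= c by rewrite addr_ge0.
have cc : c <= c1 by rewrite lerD2l.
have hc : h * c <= h * c1 by rewrite ler_wpM2l.
have [/andP[s0 s1] s2] := expRN_taylor (mulr_ge0 h0 c0).
set sg := expR (- (h * c)) in s0 s1 s2 *.
have sg01 : 0 <= sg <= 1 by rewrite expR_ge0 /=; lra.
rewrite (rf_reverse rf Zys sg01) -/o.
have v1P : `|v1| <= h * P.
  rewrite normrZ ger0_norm ?mulr_ge0 // ler_pM ?mulr_ge0 ?bp //.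
  by rewrite ler_piMr.
set e1 := ys - y - v1.
have e1P : `|e1| <= M1 * P ^+ 2 * h ^+ 2.
  apply: le_trans (hM1 _ _ Zy (rf_tangent_pt rf _ Zy) _) _.
    by apply: le_trans v1P _; rewrite ler_wpM2r.
  by rewrite -mulrA ler_wpM2l // -exprMn [P * h]mulrC lerXn2r ?nnegrE ?mulr_ge0.
have ysy : `|ys - y| <= b1 * h.
  rewrite -(subrK v1 (ys - y)) -/e1; apply: le_trans (ler_normD _ _) _.
  have : M1 * P ^+ 2 * h ^+ 2 <= M1 * P ^+ 2 * (T * h).
    by rewrite ler_wpM2l ?mulr_ge0 ?exprn_ge0 // expr2 ler_wpM2r.
  rewrite /b1; lra.
set v2 := (1 - sg) *: logm M ys o.
have v2P : `|v2| <= h * (c1 * La).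
  rewrite normrZ ger0_norm // mulrA ler_pM ?bl //.
  exact: le_trans s1 hc.
set e2 := expm M ys v2 - ys - v2.
have e2P : `|e2| <= M2 * (c1 * La) ^+ 2 * h ^+ 2.
  apply: le_trans (hM2 _ _ Zys (rf_tangent_log rf _ Zys) _) _.
    by apply: le_trans v2P _; rewrite ler_wpM2r ?mulr_ge0.
  rewrite -mulrA ler_wpM2l // -exprMn [c1 * La * h]mulrC.
  by rewrite lerXn2r ?nnegrE ?mulr_ge0.
(* Four errors of order h^2: the expansions of the two exponentials, the decay 1 - sg against h c,
   and the logarithm taken at [ys] instead of [y]. *)
have -> : expm M ys v2 - y - h *: (c *: logm M y o + phi *: ptm M o y V)
  = e1 + e2 + (1 - sg - h * c) *: logm M ys o + (h * c) *: (logm M ys o - logm M y o).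
  rewrite /e1 /e2 /v1 /v2; apply/rowP => j; rewrite !mxE; ring.
clearbody c1 b1; rewrite !mulrDl.
apply: le_trans (ler_normD _ _) _; apply: lerD.
  apply: le_trans (ler_normD _ _) _; apply: lerD.
    by apply: le_trans (ler_normD _ _) _; apply: lerD.
  rewrite normrZ mulrAC ler_pM ?bl // (le_trans s2) // -exprMn lerXn2r ?nnegrE ?mulr_ge0 //.
  by rewrite [c1 * h]mulrC.
rewrite normrZ ger0_norm ?mulr_ge0 //.
have -> : c1 * (La * b1) * h ^+ 2 = (h * c1) * (La * (b1 * h)) by ring.
rewrite ler_pM ?mulr_ge0 //.
by apply: le_trans (ll _ _ Zys Zy) _; rewrite ler_wpM2l.
Qed.

(** * Block vectors and the sup norm *)

Section ProductNorm.
Variables (R : realType) (k : nat) (kd : 'I_k -> model R) (n : 'I_k -> nat).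
Implicit Types x y : Pamb kd n.

Lemma fcompB x y i : fcomp (x - y) i = fcomp x i - fcomp y i.
Proof. by apply/rowP => j; rewrite !mxE. Qed.

Lemma fcompZ (a : R) x i : fcomp (a *: x) i = a *: fcomp x i.
Proof. by apply/rowP => j; rewrite !mxE. Qed.

Lemma fcomp_mk g i : fcomp (mk g : Pamb kd n) i = g i.
Proof. by rewrite /fcomp /mk mxrowK. Qed.

Lemma fcomp_norm_le x i : `|fcomp x i| <= `|x|.
Proof. by apply: rV_norm_le => // j; rewrite !mxE; exact: rV_coord_le. Qed.

Lemma Pamb_norm_le x (a : R) : 0 <= a -> (forall i, `|fcomp x i| <= a) -> `|x| <= a.
Proof.
move=> a0 h; apply: rV_norm_le => // j.
apply: le_trans (h (tagnat.sig1 j)).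
have -> : x 0 j = fcomp x (tagnat.sig1 j) 0 (tagnat.sig2 j).
  by rewrite -{1}(submxrowK x) mxE.
exact: rV_coord_le.
Qed.

Lemma blip_mk (W : normedModType R) (S : set W)
    (g : forall i, W -> 'rV[R]_(dims kd n i)) :
  (forall i, blip S (g i)) -> blip S (fun p => mk (fun i => g i p) : Pamb kd n).
Proof.
move=> hg.
have /choice[M hM] : forall i, exists M, 0 <= M /\ (forall p, S p -> `|g i p| <= M) /\
    (forall p q, S p -> S q -> `|g i p - g i q| <= M * `|p - q|).
  by move=> i; have [M M0 [h1 h2]] := hg i; exists M.
have Mle i : M i <= \sum_i M i.
  by rewrite (bigD1 i) //= lerDl sumr_ge0 // => j _; exact: (hM j).1.
have S0 : 0 <= \sum_i M i by apply: sumr_ge0 => j _; exact: (hM j).1.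
exists (\sum_i M i) => //; split=> [p Sp|p q Sp Sq].
  apply: Pamb_norm_le => // i; rewrite fcomp_mk.
  exact: le_trans ((hM i).2.1 _ Sp) (Mle i).
apply: Pamb_norm_le => [|i]; first by rewrite mulr_ge0.
rewrite fcompB !fcomp_mk; apply: le_trans ((hM i).2.2 _ _ Sp Sq) _.
by rewrite ler_wpM2r.
Qed.

End ProductNorm.

Lemma pair_norm_le (R : realType) (U W : normedModType R) (p : U * W) (a : R) :
  `|p.1| <= a -> `|p.2| <= a -> `|p| <= a.
Proof. by move=> h1 h2; rewrite [leLHS]/Num.Def.normr /= ge_max h1 h2. Qed.

Lemma fst_norm_le (R : realType) (U W : normedModType R) (p : U * W) : `|p.1| <= `|p|.
Proof. by rewrite [leRHS]/Num.Def.normr /= le_max lexx. Qed.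

(** * Convergence of a consistent one-step method *)

(* [adm h t z] says that the intermediate point of the step [Phi h t z] stays in
   the region; the one-step error is only controlled there. *)
Lemma one_step_convergence (R : realType) (m : nat) (F : 'rV[R]_m -> R -> 'rV[R]_m)
    (T : R) (x : R -> 'rV[R]_m) (K : set 'rV[R]_m)
    (Phi : R -> R -> 'rV[R]_m -> 'rV[R]_m) (adm : R -> R -> 'rV[R]_m -> Prop)
    (C : R) (y : R -> nat -> 'rV[R]_m) :
  0 < T -> 0 <= C ->
  blip [set p | K p.1 /\ 0 <= p.2 <= T] (fun p : 'rV[R]_m * R => F p.1 p.2) ->
  {within `[0, T], continuous x} ->
  (forall t, 0 < t < T -> derivable x t 1 /\ 'D_1 x t = F (x t) t) ->
  (forall t, 0 <= t <= T -> K (x t)) ->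
  (forall h t z, K z -> 0 <= t <= T -> 0 <= h <= T -> adm h t z ->
    `|Phi h t z - z - h *: F z t| <= C * h ^+ 2) ->
  (forall h, y h 0%N = x 0) ->
  (forall h j, y h j.+1 = Phi h (j%:R * h) (y h j)) ->
  exists2 C' : R, 0 <= C' & forall N h, (0 < N)%N -> h = T / N%:R ->
    (forall j, (j <= N)%N -> K (y h j) /\ ((j < N)%N -> adm h (j%:R * h) (y h j))) ->
    forall j, (j <= N)%N -> `|y h j - x (j%:R * h)| <= C' * h.
Proof.
move=> T0 C0 [M M0 [bF lF]] xc xd xK cons y0 yS.
pose G t := F (x t) t.
have inS t : 0 <= t <= T -> [set p : 'rV[R]_m * R | K p.1 /\ 0 <= p.2 <= T] (x t, t).
  by move=> ht; split=> //=; exact: xK.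
have GM t : 0 <= t <= T -> `|G t| <= M by move=> /inS; exact: bF.
have xL := solution_lipschitz xc xd GM.
have GL s t : 0 <= s -> s <= t -> t <= T -> `|G t - G s| <= M * (M + 1) * (t - s).
  move=> s0 st tT; rewrite -mulrA.
  apply: le_trans (lF (x t, t) (x s, s) _ _) _.
  - by apply: inS; rewrite tT (le_trans s0).
  - by apply: inS; rewrite s0 (le_trans st).
  rewrite ler_wpM2l //; apply: pair_norm_le => /=.
    apply: le_trans (xL _ _ s0 st tT) _.
    by rewrite ler_wpM2r ?subr_ge0 // lerDl.
  by rewrite ger0_norm ?subr_ge0 // ler_peMl ?subr_ge0 // lerDr.
have xE := solution_euler_error xc xd GL.
set L := `|M * (M + 1)| in xE.
have L0 : 0 <= L by exact: normr_ge0.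
(* Gronwall with growth rate [M], the Lipschitz constant of the field, and local error C + L: [C]
   for the scheme, [L] for the exact flow, each compared with one Euler step. *)
exists ((C + L) * T * expR (M * T)).
  by rewrite !mulr_ge0 ?addr_ge0 ?expR_ge0 ?(ltW T0).
move=> N h N0 hN adms.
have Np : 0 < N%:R :> R by rewrite ltr0n.
have Nh : N%:R * h = T by rewrite hN; field; rewrite gt_eqF.
have h0 : 0 <= h by rewrite hN divr_ge0 ?(ltW T0).
have jhT j : (j <= N)%N -> 0 <= j%:R * h <= T.
  move=> jN; rewrite mulr_ge0 //= -Nh ler_wpM2r // ler_nat //.
have hT : h <= T by have /andP[] := jhT 1%N N0; rewrite mul1r.
apply: (@discrete_gronwall R (fun j => `|y h j - x (j%:R * h)|) M (C + L) h T N) => //.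
- exact: addr_ge0.
- by rewrite Nh.
- by rewrite y0 mul0r subrr normr0.
move=> j jN; rewrite yS; set t := j%:R * h.
have [Ky /(_ jN) hadm] := adms j (ltnW jN).
have tT := jhT j (ltnW jN); rewrite -/t in tT hadm.
have t1 : j.+1%:R * h = t + h by rewrite -natr1 mulrDl mul1r.
have := jhT _ jN; rewrite t1 => /andP[_ thT].
have /andP[t0 _] := tT.
have thh : t + h - t = h by ring.
have e1 := cons h t (y h j) Ky tT _ hadm; rewrite h0 hT in e1.
have := xE t (t + h) t0 _ thT; rewrite lerDl thh => /(_ h0) e2.
have e3 : `|F (y h j) t - F (x t) t| <= M * `|y h j - x t|.
  apply: le_trans (lF (y h j, t) (x t, t) _ (inS _ tT)) _; first by split.
  rewrite ler_wpM2l //; apply: pair_norm_le => //=.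
  by rewrite subrr normr0.
(* Both the scheme and the exact flow are compared with the Euler step of [F]; what remains is the
   difference of two Euler steps. *)
have -> : Phi h t (y h j) - x (t + h) =
  (Phi h t (y h j) - y h j - h *: F (y h j) t) - (x (t + h) - x t - h *: G t)
  + ((y h j - x t) + h *: (F (y h j) t - F (x t) t)).
  by apply/rowP => i; rewrite !mxE /G; ring.
apply: le_trans (ler_normD _ _) _; rewrite addrC; apply: lerD.
  apply: le_trans (ler_normD _ _) _; rewrite mulrDl mul1r lerD2l.
  rewrite normrZ (ger0_norm h0) [M * h]mulrC -mulrA ler_wpM2l //.
rewrite mulrDl; apply: le_trans (ler_normB _ _) _; apply: lerD => //.
exact: e1.
Qed.

(** * Assembly for the product manifold *)

Unset Implicit Arguments.

Theorem theorem1 (R : realType) (k : nat) (kd : 'I_k -> model R) (n : 'I_k -> nat)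
  (hparam : forall i, param_pos (kd i))
  (tau : 'I_k -> R) (htau : forall i, 0 < tau i)
  (V : Pamb kd n) (hV : forall i, is_tangent (kd i) (orig kd n i) (fcomp V i))
  (T : R) (hT : 0 < T)
  (f : 'I_k -> Pamb kd n -> R -> R)
  (hf01 : forall i (z : Pamb kd n) t, onP z -> 0 <= t <= T -> 0 <= f i z t <= 1)
  (hfC1 : forall i, exists U : set (Pamb kd n * R),
      (forall (z : Pamb kd n) t, onP z -> 0 <= t <= T -> U (z, t)) /\
      C1_on U (fun p => f i p.1 p.2))
  (x0 : Pamb kd n) (x : R -> Pamb kd n)
  (hx0 : x 0 = x0)
  (hxon : forall t, 0 <= t <= T -> onP (x t))
  (hxcont : {within `[0, T], continuous x})
  (hxode : forall t, 0 < t < T ->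
      derivable x t 1 /\ 'D_1 x t = ode_field tau V f (x t) t)
  (Kc : set (Pamb kd n)) (hKc : compact Kc) (hKon : forall z, Kc z -> onP z)
  (hKcut : forall z, Kc z -> forall i, not_cut (kd i) (orig kd n i) (fcomp z i))
  (hxK : forall t, 0 <= t <= T -> Kc (x t))
  (hiter : forall N : nat, (0 < N)%N -> forall j : nat, (j <= N)%N ->
      Kc (gd_iter tau V f (T / N%:R) x0 j) /\
      ((j < N)%N -> Kc (gd_star V f (T / N%:R) (j%:R * (T / N%:R))
                                 (gd_iter tau V f (T / N%:R) x0 j)))) :
  exists C h0 : R, 0 < C /\ 0 < h0 /\
    forall N : nat, (0 < N)%N -> T / N%:R <= h0 ->
      forall j : nat, (j <= N)%N ->
        dP (gd_iter tau V f (T / N%:R) x0 j) (x (j%:R * (T / N%:R)))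
          <= C * (T / N%:R).
Proof.
set Sx : set (Pamb kd n * R) := [set p | Kc p.1 /\ 0 <= p.2 <= T].
have cSx : compact Sx.
  have -> : Sx = Kc `*` `[0, T] by apply/seteqP; split=> -[z t] /=; rewrite in_itv.
  by apply: compact_setX => //; exact: segment_compact.
have fstSx : blip Sx (fun p => p.1).
  have [B [_ hB]] := compact_bounded hKc.
  exists (`|B| + 1 + 1) => [|]; first by rewrite !addr_ge0.
  split=> [p [Kp _]|p q _ _].
    rewrite (le_trans (hB (`|B| + 1) _ _ Kp)) ?lerDl //.
    by rewrite (le_lt_trans (ler_norm _)) // ltrDl.
  apply: le_trans (fst_norm_le (p - q)) _.
  by rewrite ler_peMl // lerDr addr_ge0.
have compSx i : blip Sx (fun p => fcomp p.1 i).
  have [M M0 [b l]] := fstSx; exists M => //; split=> [p Sp|p q Sp Sq].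
    exact: le_trans (fcomp_norm_le _ _) (b _ Sp).
  rewrite -fcompB; exact: le_trans (fcomp_norm_le _ _) (l _ _ Sp Sq).
have fSx i : blip Sx (fun p => f i p.1 p.2).
  have [U [hU C1U]] := hfC1 i.
  have b1 p : Sx p -> `|f i p.1 p.2| <= 1.
    move=> [Kp tp]; have /andP[f0 f1] := hf01 i _ _ (hKon _ Kp) tp.
    by rewrite ger0_norm.
  have [L L0 hL] : exists2 L : R, 0 <= L & forall p q, Sx p -> Sx q ->
      `|f i p.1 p.2 - f i q.1 q.2| <= L * `|p - q|.
    apply: (@compact_locally_lipschitz R _ Sx (fun p => f i p.1 p.2) 1) => // -[z t] [Kz tz].
    by apply: C1_locally_lipschitz C1U _; apply: hU => //; exact: hKon.
  exists (1 + L) => [|]; first by rewrite addr_ge0.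
  split=> [p Sp|p q Sp Sq]; first by rewrite (le_trans (b1 _ Sp)) // lerDl.
  by apply: le_trans (hL _ _ Sp Sq) _; rewrite ler_wpM2r // lerDr.
have rf i : regular_factor (kd i) (fcomp V i) ((fun z => fcomp z i) @` Kc).
  apply: regular_factor_compact => //.
  - by move=> p q; rewrite -fcompB; exact: fcomp_norm_le.
  - by move=> p; exact: fcomp_norm_le.
  - exact: origin_on_model.
  - by move=> p Kp; exact: hKon.
  - by move=> p Kp; exact: hKcut.
have imZ i p : Sx p -> ((fun z => fcomp z i) @` Kc) (fcomp p.1 i).
  by move=> [Kp _]; exists p.1.
have FSx : blip Sx (fun p => ode_field tau V f p.1 p.2).
  apply: blip_mk => i; apply: blipD; apply: blipZ.
  - by apply: blipD => //; exact: blip_cst.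
  - exact: (blip_precomp (rf_log (rf i)) (imZ i) (compSx i)).
  - exact: fSx.
  - exact: (blip_precomp (rf_pt (rf i)) (imZ i) (compSx i)).
(* One constant is chosen for each factor; their sum dominates each of them and serves the
   product. *)
have /choice[Ce hCe] : forall i, exists C, 0 <= C /\ _ :=
  fun i => let: ex_intro2 C C0 hC := factor_step_error (rf i) (htau i) (ltW hT) in
           ex_intro _ C (conj C0 hC).
have Ce_le i : Ce i <= \sum_i Ce i.
  by rewrite (bigD1 i) //= lerDl sumr_ge0 // => j _; exact: (hCe j).1.
have Ce0 : 0 <= \sum_i Ce i by apply: sumr_ge0 => j _; exact: (hCe j).1.
have cons h t z : Kc z -> 0 <= t <= T -> 0 <= h <= T -> Kc (gd_star V f h t z) ->
    `|gd_step tau V f h t z - z - h *: ode_field tau V f z t|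
      <= (\sum_i Ce i) * h ^+ 2.
  move=> Kz tT hT' Ks; apply: Pamb_norm_le => [|i].
    by rewrite mulr_ge0 // sqr_ge0.
  apply: le_trans (_ : Ce i * h ^+ 2 <= _); last by rewrite ler_wpM2r ?sqr_ge0.
  rewrite !fcompB fcompZ !fcomp_mk.
  apply: (hCe i).2 => //; first by exists z.
    by apply: hf01 => //; exact: hKon.
  by exists (gd_star V f h t z) => //; rewrite fcomp_mk.
have [C' C'0 hC'] := one_step_convergence hT Ce0 FSx hxcont hxode hxK cons
   (y := fun h j => gd_iter tau V f h x0 j) (fun _ => esym hx0) (fun _ _ => erefl).
have /choice[Cd hCd] : forall i, exists C, 0 <= C /\ _ :=
  fun i => let: ex_intro2 C C0 hC := rf_dist (rf i) in ex_intro _ C (conj C0 hC).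
have Cd0 : 0 <= \sum_i Cd i by apply: sumr_ge0 => j _; exact: (hCd j).1.
(* The estimate holds for every positive N, so h0 = 1 is an arbitrary choice. The added 1 makes the
   constant positive even when the product vanishes, as for k = 0. *)
exists ((\sum_i Cd i) * C' + 1), 1; split; last split=> //.
  by rewrite ltr_wpDl // mulr_ge0.
move=> N N0 _ j jN.
have Np : 0 < N%:R :> R by rewrite ltr0n.
set h := T / N%:R.
have h0 : 0 <= h by rewrite divr_ge0 ?(ltW hT).
have err := hC' N h N0 erefl (hiter N N0) j jN.
have jhT : 0 <= j%:R * h <= T.
  rewrite mulr_ge0 //= /h mulrA ler_pdivrMr // mulrC ler_pM2l // ler_nat.
  by [].
have [Ky _] := hiter N N0 j jN; rewrite -/h in Ky.
have Kx := hxK _ jhT.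
apply: (@le_trans _ _ ((\sum_i Cd i) * `|gd_iter tau V f h x0 j - x (j%:R * h)|)).
  rewrite /dP mulr_suml; apply: ler_sum => i _.
  apply: le_trans ((hCd i).2 _ _ _ _) _; [by eexists; first exact: Ky | |].
    by eexists; first exact: Kx.
  by rewrite ler_wpM2l ?(hCd i).1 // -fcompB fcomp_norm_le.
rewrite mulrDl mul1r -mulrA; apply: le_trans (_ : _ <= (\sum_i Cd i) * (C' * h)) _.
  by rewrite ler_wpM2l.
by rewrite lerDl.
Qed.
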